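(* Let $n\ge 1$ be an integer, let $f\in C^1(\mathbb{T},(0,\infty))$ and $g\in C^2(\mathbb{T},(0,\infty))$. Assume that $f(x)=f(1-x)$ and $g(x)=g(1-x)$ for all $x\in[0,1]$, that $f'(x)\ge0$ and $g'(x)\ge0$ for all $x\in[0,\frac12]$, that $g(0)<g(\frac12)$, and that $\max_{\mathbb{T}}f\,\max_{\mathbb{T}}g<n-1$. Let $u$ be the ($\mathbb{Z}$-periodic in $x$) solution, with quenching time $T^\ast$, of $$u_t=\frac{u_{xx}}{(u_x)^2+1}-\frac{n-1}{u}+f(x)\sqrt{(u_x)^2+1}\quad\text{for } x\in\mathbb{R},\ t\in(0,T^\ast),\qquad u(x,0)=g(x)\quad\text{for } x\in\mathbb{R}.$$ Then $$\lim_{t\to(T^\ast)^-}u(k,t)=0\quad\text{for all } k\in\mathbb{Z},\qquad \lim_{t\to(T^\ast)^-}u(x,t)>0\quad\text{for all } x\in\mathbb{R}\setminus\mathbb{Z}$$ (in particular, these limits exist).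
   Context: $\mathbb{T}=\mathbb{R}/\mathbb{Z}$ is the one-dimensional flat torus; functions on $\mathbb{T}$ are identified with $\mathbb{Z}$-periodic functions on $\mathbb{R}$. The solution $u$ is the unique positive classical solution ($\mathbb{Z}$-periodic in $x$), which exists as long as its infimum over $x$ stays positive. The quenching time is $T^\ast:=\sup\{t>0\mid \inf_{x\in\mathbb{R}}u(x,t)>0\}\in(0,\infty]$; if $T^\ast<\infty$, the solution reaches the value $0$ at time $T^\ast$, i.e. $\inf_{\mathbb{R}\times[0,T^\ast)}u=0$. Under the hypotheses of the claim it is known that $T^\ast<\infty$. *)

(* Defs.v *)
From HB Require Import structures.
From mathcomp Require Import all_boot all_order all_algebra.
From mathcomp Require Import all_classical all_reals all_analysis.
Set Implicit Arguments.
Unset Strict Implicit.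
Unset Printing Implicit Defensive.
Import Order.TTheory GRing.Theory Num.Theory.
Import numFieldNormedType.Exports.
Local Open Scope classical_set_scope.
Local Open Scope ring_scope.

(* f \in C^k(T, (0, oo)), where functions on the torus T = R/Z are identified
   with 1-periodic functions on R. *)
Definition torus_pos_Ck (R : realType) (k : nat) (f : R -> R) : Prop :=
  [/\ periodic f 1,
      forall x : R, 0 < f x,
      forall (i : nat) (x : R), (i < k)%N -> derivable (derive1n i f) x 1 &
      continuous (derive1n k f)].

Section Flow.
Context {R : realType}.
Implicit Types (u : R -> R -> R) (S : \bar R).

(* Space comes first and time second: [u x t]. *)
Definition dx u (x t : R) : R := derive1 (u ^~ t) x.
Definition dxx u (x t : R) : R := derive1 (dx u ^~ t) x.
Definition dt u (x t : R) : R := derive1 (u x) t.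

(* R x [0, S) and R x (0, S), with S possibly infinite *)
Definition slab S : set (R * R) := [set p | 0 <= p.2 /\ (p.2%:E < S)%E].
Definition open_slab S : set (R * R) := [set p | 0 < p.2 /\ (p.2%:E < S)%E].

(* u, u_x, u_xx and u_t exist and are jointly continuous on R x (0, S) *)
Definition C21 S u : Prop :=
  (forall x t : R, 0 < t -> (t%:E < S)%E ->
     [/\ derivable (u ^~ t) x 1, derivable (dx u ^~ t) x 1 &
         derivable (u x) t 1]) /\
  [/\ {within open_slab S, continuous (fun p : R * R => u p.1 p.2)},
      {within open_slab S, continuous (fun p : R * R => dx u p.1 p.2)},
      {within open_slab S, continuous (fun p : R * R => dxx u p.1 p.2)} &
      {within open_slab S, continuous (fun p : R * R => dt u p.1 p.2)}].

(* A positive classical solution on R x [0, S); the values [u x t] with t < 0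
   or t >= S are irrelevant. *)
Definition positive_classical_solution (n : nat) (f g : R -> R) S u : Prop :=
  [/\ {within slab S, continuous (fun p : R * R => u p.1 p.2)} /\ C21 S u,
      forall t : R, 0 <= t -> (t%:E < S)%E -> periodic (u ^~ t) 1,
      forall x t : R, 0 <= t -> (t%:E < S)%E -> 0 < u x t,
      forall x t : R, 0 < t -> (t%:E < S)%E ->
        dt u x t = dxx u x t / ((dx u x t) ^+ 2 + 1) - (n%:R - 1) / u x t
                   + f x * Num.sqrt ((dx u x t) ^+ 2 + 1) &
      forall x : R, u x 0 = g x].

(* A positive classical solution on its whole interval of existence [0, S):
   the solution exists as long as its infimum stays positive, so that a finite
   S can only occur because u reaches 0 there.  The infimum is over a nonempty
   set of positive reals, hence never a default value of [inf]. *)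
Definition maximal_solution (n : nat) (f g : R -> R) S u : Prop :=
  [/\ (0 < S)%E, positive_classical_solution n f g S u &
      (S < +oo)%E -> inf [set u p.1 p.2 | p in slab S] = 0].

(* sup {t > 0 | inf_x u(x, t) > 0}, where t ranges over the interval of
   existence [0, S) of u *)
Definition quenching_time S u : \bar R :=
  ereal_sup [set t%:E | t in [set t : R |
    [/\ 0 < t, (t%:E < S)%E & 0 < inf (range (u ^~ t))]]].

End Flow.

(* Main.v *)
(* At a first touching point of two comparison functions their slopes agree and
   their second derivatives are ordered, so that the equation yields a
   contradiction.  This maximum principle is used with one space variable for
   barriers, and with two space variables x <= y for functions of the form
   u(y,t) - u(x,t) - (C(y,t) - C(x,t)), which gives lower bounds for u_x
   without differentiating the equation.

   Comparing u(-x,t) with u(x,t) shows that u(.,t) is even, and C = 0 shows that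
   it is nondecreasing on [0,1/2].  The maximum u(1/2,t) decreases at least
   linearly, so the horizon T is finite, and (u(0,t)^2)' >= -2(n-1), so u(0,t)
   tends to 0.  With C_x a small bump, supported initially where g' > 0 and whose
   left end reaches 0 at time T, the increments of u away from 0 stay bounded
   below up to time T; hence u stays positive off the integers.

   For the existence of the limits, quadratic upper barriers show that
   limsup u(x,.) <= liminf u(y,.) for 0 <= x < y <= 1/2, so that u(x,.)
   converges unless x is a jump of the nondecreasing function limsup u(x,.).
   A jump is excluded by choosing two intervals on which this function is nearly
   constant, one on each side of x, and comparing in between u(x + h(t),t) with
   u(x,t), where the shift h solves h' = -F h for a Lipschitz constant F of the
   forcing term f. *)

Require Import Defs.
From HB Require Import structures.
From mathcomp Require Import all_boot all_order all_algebra.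
From mathcomp Require Import all_classical all_reals all_analysis.
From mathcomp Require Import ring lra.
Import Order.TTheory GRing.Theory Num.Theory.
Import numFieldNormedType.Exports.
Local Open Scope classical_set_scope.
Local Open Scope ring_scope.
Set Implicit Arguments.
Unset Strict Implicit.
Unset Printing Implicit Defensive.

(** * One-sided derivative tests *)

(* [is_derive] without its typeclass status, so that derivatives are computed
   by explicit rules and in a predictable form. *)
Definition has_deriv {R : realType} (x : R) (f : R -> R) (d : R) : Prop :=
  is_derive x 1 f d.

Section Calculus.
Context {R : realType}.
Implicit Types (f g : R -> R) (x d : R).

(** The division-free form of differentiability also covers [y = x], so increments can be estimated
    by the triangle inequality without case distinctions. *)
Lemma has_deriv_eps f x d : has_deriv x f d <->
  forall e : R, 0 < e -> exists2 r : R, 0 < r &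
    forall y : R, `|y - x| < r -> `|f y - f x - d * (y - x)| <= e * `|y - x|.
Proof.
split=> [[df dfE] e e0|H].
  have /cvgrPdist_le/(_ e e0) : (fun h => h^-1 *: (f (h *: 1 + x) - f x)) @ 0^' --> d.
    by rewrite -dfE; exact: df.
  move=> [r /= r0 Hr].
  have {}Hr (h : R) : `|h| < r -> h != 0 -> `|h^-1 * (f (h + x) - f x) - d| <= e.
    move=> hr h0; have := Hr h; rewrite /= sub0r normrN => /(_ hr h0).
    by rewrite /GRing.scale /= mulr1 distrC.
  exists r => // y yr.
  have [->|yx] := eqVneq y x; first by rewrite !subrr mulr0 subr0 normr0 mulr0.
  have yx0 : y - x != 0 by rewrite subr_eq0.
  have := Hr (y - x) yr yx0; rewrite subrK => {}Hr.
  rewrite -ler_pdivrMr ?normr_gt0// -normfV -normrM.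
  suff -> : (f y - f x - d * (y - x)) * (y - x)^-1 =
    (y - x)^-1 * (f y - f x) - d by [].
  by field.
have Hc : (fun h => h^-1 *: (f (h *: 1 + x) - f x)) @ 0^' --> d.
  apply/cvgrPdist_le => e e0; have [r r0 Hr] := H e e0.
  exists r => //= h; rewrite /= sub0r normrN => hr h0.
  have := Hr (h + x); rewrite addrK => /(_ hr) {}Hr.
  rewrite /GRing.scale /= mulr1 distrC.
  move: Hr; rewrite -ler_pdivrMr ?normr_gt0// -normfV -normrM.
  suff -> : (f (h + x) - f x - d * h) * h^-1 = h^-1 * (f (h + x) - f x) - d by [].
  by field.
apply: DeriveDef; first by apply/cvg_ex; exists d.
exact/cvg_lim.
Qed.

Lemma has_deriv_ge0_right f x d r : 0 < r -> has_deriv x f d ->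
  (forall y, x < y < x + r -> f x <= f y) -> 0 <= d.
Proof.
move=> r0 /has_deriv_eps df H; rewrite leNgt; apply/negP => d0.
(* With tolerance [- d / 2] the increment over a small [h] is at most [d * h / 2 < 0]. *)
have [s s0 Hs] := df (- d / 2) ltac:(lra).
pose h := Num.min (r / 2) (s / 2).
have h0 : 0 < h by rewrite /h lt_min; apply/andP; split; lra.
have hr : h <= r / 2 by rewrite /h ge_min lexx.
have hs : h <= s / 2 by rewrite /h ge_min lexx orbT.
have := Hs (x + h); rewrite (addrC x h) addrK (gtr0_norm h0) => /(_ ltac:(lra)).
have := H (x + h) ltac:(lra); rewrite (addrC x h).
rewrite ler_norml => H1 /andP[_ H2].
have : d * h < 0 by rewrite nmulr_rlt0.
lra.
Qed.

Lemma has_deriv_refl f x d : has_deriv (- x) f d -> has_deriv x (fun y => f (- y)) (- d).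
Proof.
move=> /has_deriv_eps H; apply/has_deriv_eps => e /H[r r0 Hr]; exists r => // y yr.
have -> : - d * (y - x) = d * (- y - - x) by ring.
have E : `|y - x| = `| - y - - x| by rewrite -opprD normrN.
by rewrite E; apply: Hr; rewrite -E.
Qed.

Lemma has_deriv_le0_left f x d r : 0 < r -> has_deriv x f d ->
  (forall y, x - r < y < x -> f x <= f y) -> d <= 0.
Proof.
move=> r0 df H; rewrite -oppr_ge0.
apply: (@has_deriv_ge0_right (fun y => f (- y)) (- x) (- d) r r0).
  by apply: has_deriv_refl; rewrite opprK.
by move=> y yx; rewrite opprK; apply: H; lra.
Qed.

Lemma has_deriv_continuous f x d : has_deriv x f d -> {for x, continuous f}.
Proof. by case=> /derivable1_diffP /differentiable_continuous. Qed.

Lemma mvt f df (a b : R) : a < b ->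
  (forall x, a <= x <= b -> has_deriv x f (df x)) ->
  exists2 c, a < c < b & f b - f a = df c * (b - a).
Proof.
move=> ab H; have [||c] := @MVT _ f df _ _ ab.
- by move=> x; rewrite in_itv /= => /andP[? ?]; apply: H; lra.
- apply: continuous_in_subspaceT => x; rewrite inE /= in_itv /= => /H.
  exact: has_deriv_continuous.
- by rewrite in_itv /= => cab E; exists c.
Qed.

(** The order of [a] and [b] is left open because a moving point may lie on either side of its
    position at the reference time. *)
Lemma mvt_dist f df (a b : R) :
  (forall y, `|y - a| <= `|b - a| -> has_deriv y f (df y)) ->
  exists2 c, `|c - a| <= `|b - a| & f b - f a = df c * (b - a).
Proof.
move=> H; have [ba|ab|->] := ltrgtP b a; last first.
- by exists a; rewrite ?subrr ?normr0// mulr0.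
- have [|c cab E] := @mvt f df a b ab.
    by move=> y yab; apply: H; rewrite !ger0_norm; lra.
  by exists c; rewrite // !ger0_norm; lra.
have [|c cba E] := @mvt f df b a ba.
  by move=> y yba; apply: H; rewrite !ler0_norm; lra.
by exists c; rewrite // ?ler0_norm; lra.
Qed.

(** If [d2] were negative, [df] would be negative just to the right of its zero [x], and [f] would
    decrease there by the mean value theorem. Being one-sided, the test also applies at a boundary
    point where the slope is known to vanish. *)
Lemma has_deriv2_ge0_right f df x d2 r : 0 < r ->
  (forall y, x <= y < x + r -> has_deriv y f (df y)) ->
  has_deriv x df d2 -> df x = 0 ->
  (forall y, x < y < x + r -> f x <= f y) -> 0 <= d2.
Proof.
move=> r0 Hf /has_deriv_eps Hd df0 H; rewrite leNgt; apply/negP => d0.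
have [s s0 Hs] := Hd (- d2 / 2) ltac:(lra).
pose h := Num.min (r / 2) (s / 2).
have h0 : 0 < h by rewrite /h lt_min; apply/andP; split; lra.
have hr : h <= r / 2 by rewrite /h ge_min lexx.
have hs : h <= s / 2 by rewrite /h ge_min lexx orbT.
have [|c cxh] := @mvt f df x (x + h) ltac:(lra).
  by move=> y yxh; apply: Hf; lra.
have := H (x + h) ltac:(lra).
have c0 : 0 < c - x by lra.
have := Hs c; rewrite (gtr0_norm c0) df0 subr0 => /(_ ltac:(lra)).
rewrite ler_norml => /andP[_ H2] H1 E.
have H3 : d2 * (c - x) < 0 by rewrite nmulr_rlt0.
have H4 : df c < 0 by lra.
have : df c * (x + h - x) < 0 by rewrite nmulr_rlt0//; lra.
lra.
Qed.

Lemma has_deriv2_ge0_left f df x d2 r : 0 < r ->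
  (forall y, x - r < y <= x -> has_deriv y f (df y)) ->
  has_deriv x df d2 -> df x = 0 ->
  (forall y, x - r < y < x -> f x <= f y) -> 0 <= d2.
Proof.
move=> r0 Hf Hd df0 H.
apply: (@has_deriv2_ge0_right (fun y => f (- y)) (fun y => - df (- y)) (- x) d2 r r0).
- by move=> y yx; apply: has_deriv_refl; apply: Hf; lra.
- rewrite -[d2]opprK; apply: is_deriveN; apply: has_deriv_refl.
  by rewrite opprK.
- by rewrite opprK df0 oppr0.
- by move=> y yx; rewrite opprK; apply: H; lra.
Qed.

(* The increment is split as
   u(xi s, s) - u(xi t, s) + u(xi t, s) - u(xi t, t), and the mean value
   theorem in space applies to the first difference. *)
Lemma has_deriv_along (u ux : R -> R -> R) (xi : R -> R) (t dxi ut r : R) :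
  0 < r ->
  (forall y s, `|y - xi t| < r -> `|s - t| < r ->
     has_deriv y (u ^~ s) (ux y s)) ->
  (forall e, 0 < e -> exists2 r', 0 < r' & forall y s,
     `|y - xi t| < r' -> `|s - t| < r' -> `|ux y s - ux (xi t) t| <= e) ->
  has_deriv t (u (xi t)) ut -> has_deriv t xi dxi ->
  has_deriv t (fun s => u (xi s) s) (ux (xi t) t * dxi + ut).
Proof.
move=> r0 Hx Hc /has_deriv_eps Hut /has_deriv_eps Hxi; apply/has_deriv_eps => e e0.
set p := ux (xi t) t.
have M0 : 0 < `|dxi| + 1 + `|p| + 1 by rewrite ltr_wpDr// ltr_wpDr// ltr_wpDl.
(* The bound [e1 <= 1] makes [xi] Lipschitz at [t] with constant [|dxi| + 1]; the other bound makes
   the three error terms add up to at most [e / 2]. *)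
pose e1 := Num.min 1 (e / 2 / (`|dxi| + 1 + `|p| + 1)).
have e10 : 0 < e1 by rewrite lt_min ltr01 divr_gt0// divr_gt0.
have e11 : e1 <= 1 by rewrite ge_min lexx.
have e1e : e1 * (`|dxi| + 1 + `|p| + 1) <= e / 2.
  by rewrite -ler_pdivlMr// ge_min lexx orbT.
have [r1 r10 H1] := Hc e1 e10.
have [r2 r20 H2] := Hut e1 e10.
have [r3 r30 H3] := Hxi e1 e10.
pose m := Num.min r r1.
have m0 : 0 < m by rewrite lt_min r0.
have mr : m <= r by rewrite ge_min lexx.
have mr1 : m <= r1 by rewrite ge_min lexx orbT.
have D0 : 0 < `|dxi| + 1 by rewrite ltr_wpDl.
pose r' := Num.min m (Num.min r2 (Num.min r3 (m / (`|dxi| + 1)))).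
have mD : 0 < m / (`|dxi| + 1) by rewrite divr_gt0.
exists r' => [|s].
  by rewrite lt_min m0 lt_min r20 lt_min r30.
rewrite lt_min => /andP[sm]; rewrite lt_min => /andP[sr2].
rewrite lt_min => /andP[sr3 sD].
have {}H2 := H2 s sr2.
have {}H3 := H3 s sr3.
have xis : `|xi s - xi t| <= (`|dxi| + 1) * `|s - t|.
  have -> : xi s - xi t = (xi s - xi t - dxi * (s - t)) + dxi * (s - t) by ring.
  apply: le_trans (ler_normD _ _) _; rewrite normrM mulrDl mul1r addrC lerD2l.
  by apply: le_trans H3 _; apply: ler_piMl.
have xism : `|xi s - xi t| < m.
  apply: le_lt_trans xis _; rewrite mulrC -ltr_pdivlMr//.
have [|c cst E] := @mvt_dist (u ^~ s) (ux ^~ s) (xi t) (xi s).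
  move=> y yst; apply: Hx (lt_le_trans sm mr).
  exact: le_lt_trans yst (lt_le_trans xism mr).
pose q := ux c s.
have Hq : `|q - p| <= e1.
  apply: H1 (lt_le_trans sm mr1).
  exact: le_lt_trans cst (lt_le_trans xism mr1).
rewrite -/q in E.
have -> : u (xi s) s - u (xi t) t - (p * dxi + ut) * (s - t) =
  (q - p) * (xi s - xi t) + p * (xi s - xi t - dxi * (s - t)) +
  (u (xi t) s - u (xi t) t - ut * (s - t)).
  have -> : u (xi s) s = q * (xi s - xi t) + u (xi t) s by rewrite -E subrK.
  ring.
apply: le_trans (ler_normD _ _) _.
apply: (@le_trans _ _ (e1 * ((`|dxi| + 1) * `|s - t|) + `|p| * (e1 * `|s - t|) + e1 * `|s - t|)).
  apply: lerD => //; apply: le_trans (ler_normD _ _) _.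
  by rewrite !normrM; apply: lerD; [apply: ler_pM|apply: ler_wpM2l].
have -> : e1 * ((`|dxi| + 1) * `|s - t|) + `|p| * (e1 * `|s - t|) + e1 * `|s - t|
  = e1 * (`|dxi| + 1 + `|p| + 1) * `|s - t| by ring.
by apply: ler_wpM2r => //; apply: le_trans e1e _; rewrite ler_pdivrMr// ler_pMr// ler1n.
Qed.

End Calculus.

(** * The maximum principle *)

Section FirstTouch.
Context {R : realType} {X : topologicalType}.

(** The part of the cylinder where [W <= 0] is compact and nonempty, so the time coordinate attains
    a minimum on it. Before that time [W] is positive, and by continuity it is nonnegative at that
    time. *)
Lemma first_touch (K : set X) (W : X -> R -> R) (s tau : R) (x1 : X) (t1 : R) :
  compact K -> {within K `*` `[s, tau], continuous (fun p => W p.1 p.2)} ->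
  (forall x, K x -> 0 < W x s) -> K x1 -> s <= t1 <= tau -> W x1 t1 <= 0 ->
  exists x t, [/\ K x, s < t <= tau, W x t = 0 &
    forall y r, K y -> s <= r <= t -> 0 <= W y r].
Proof.
move=> cK cW Ws Kx1 t1s Wx1.
set A := K `*` `[s, tau] in cW *.
pose N := [set p : X * R | W p.1 p.2 <= 0].
have cZ : compact (A `&` N).
  have /continuous_closedP/(_ _ (@closed_le R 0)) := cW.
  move=> /closed_subspaceP[V cV VE].
  have -> : A `&` N = A `&` V by rewrite setIC -VE setIC.
  apply: compact_closedI => //.
  by apply: compact_setX => //; exact: segment_compact.
have Z0 : (A `&` N) !=set0.
  by exists (x1, t1); split => //; split => //=; rewrite in_itv.
have [|[x t]] := @compact_EVT_min _ R snd _ Z0 cZ.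
  by apply: continuous_subspaceT => p; exact: cvg_snd.
rewrite inE => -[[/= Kx]]; rewrite in_itv /= => /andP[st ttau] Wxt tmin.
have {}st : s < t.
  by rewrite lt_neqAle st andbT; apply/eqP => E; have := Ws x Kx; rewrite E ltNge Wxt.
have Wlt y r : K y -> s <= r < t -> 0 < W y r.
  move=> Ky /andP[sr rt]; rewrite ltNge; apply/negP => Wyr.
  have := tmin (y, r); rewrite inE /= leNgt rt => /(_ _)/negP; apply => //.
  by split => //; split => //=; rewrite in_itv /= sr (ltW (lt_le_trans rt ttau)).
have Wle y r : K y -> s <= r <= t -> 0 <= W y r.
  move=> Ky /andP[sr]; rewrite le_eqVlt => /orP[/eqP->|rt]; last first.
    by apply/ltW/Wlt => //; rewrite sr.
  rewrite leNgt; apply/negP => Wyt.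
  have Ayt : A (y, t) by split => //=; rewrite in_itv /= (ltW st).
  have /subspace_continuousP/(_ _ Ayt) := cW.
  (* A negative value at time [t] would persist at the slightly earlier time [q] below, where [W] is
     positive. *)
  move=> /cvgrPdist_lt/(_ (- W y t)); rewrite oppr_gt0 => /(_ Wyt).
  move=> [[B C] /= [/nbhs_singleton By [e /= e0 He]] BC].
  pose q := Num.max s (t - e / 2).
  have qs : s <= q by rewrite le_max lexx.
  have qe : t - e / 2 <= q by rewrite le_max lexx orbT.
  have qt : q < t by rewrite gt_max st; lra.
  have Byq : (B `*` C) (y, q).
    by split => //=; apply: He => /=; rewrite ger0_norm; lra.
  have Ayq : A (y, q) by split => //=; rewrite in_itv /= qs /=; apply: le_trans (ltW qt) ttau.
  have : `|W y t - W y q| < - W y t := BC _ Byq Ayq.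
  rewrite ltr_norml => /andP[? ?].
  by have := Wlt y q Ky; rewrite qs qt => /(_ isT) Wq; lra.
exists x, t; split => //; first by rewrite st.
by apply/eqP; rewrite eq_le Wxt Wle// (ltW st) lexx.
Qed.

(** At a first zero, [W] was nonnegative just before, so its time derivative cannot be positive. The
    space [X] is arbitrary in order to cover a single point, an interval and a triangle of pairs of
    points. *)
Lemma max_principle (K : set X) (W : X -> R -> R) (s tau : R) :
  compact K -> {within K `*` `[s, tau], continuous (fun p => W p.1 p.2)} ->
  (forall x, K x -> 0 < W x s) ->
  (forall x t, K x -> s < t <= tau -> W x t = 0 ->
     (forall y, K y -> 0 <= W y t) -> exists2 d, has_deriv t (W x) d & 0 < d) ->
  forall x t, K x -> s <= t <= tau -> 0 < W x t.
Proof.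
move=> cK cW Ws Wt x t Kx st; rewrite ltNge; apply/negP => Wxt.
have [y [r [Ky /andP[sr rtau] Wyr H]]] := first_touch cK cW Ws Kx st Wxt.
have [||d dW d0] := Wt y r Ky _ Wyr.
- by rewrite sr.
- by move=> z Kz; apply: H; rewrite // lexx ltW.
suff : d <= 0 by rewrite leNgt d0.
apply: (@has_deriv_le0_left _ (W y) r d (r - s)) => //; first by rewrite subr_gt0.
move=> q /andP[q1 q2]; rewrite Wyr; apply: H => //.
by rewrite (ltW q2) andbT; lra.
Qed.

End FirstTouch.

(** * Rules for computing derivatives *)

Section Derivation.
Context {R : realType}.
Implicit Types (f g : R -> R) (x a b : R).

Lemma has_deriv_eqr f x a b : has_deriv x f a -> a = b -> has_deriv x f b.
Proof. by move=> + <-. Qed.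

Lemma has_deriv_add f g x a b : has_deriv x f a -> has_deriv x g b ->
  has_deriv x (fun y => f y + g y) (a + b).
Proof. exact: is_deriveD. Qed.

Lemma has_deriv_opp f x a : has_deriv x f a -> has_deriv x (fun y => - f y) (- a).
Proof. exact: is_deriveN. Qed.

Lemma has_deriv_mul f g x a b : has_deriv x f a -> has_deriv x g b ->
  has_deriv x (fun y => f y * g y) (f x * b + g x * a).
Proof. exact: is_deriveM. Qed.

Lemma has_deriv_const c x : has_deriv x (fun=> c : R) 0.
Proof. exact: is_derive_cst. Qed.

Lemma has_deriv_var x : has_deriv x (fun y : R => y) 1.
Proof. exact: is_derive_id. Qed.

Lemma has_deriv_inv f x a : f x != 0 -> has_deriv x f a ->
  has_deriv x (fun y => (f y)^-1) (- a / f x ^+ 2).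
Proof.
move=> fx0 df; have := is_deriveV fx0 df.
by rewrite /GRing.scale /= mulNr [in X in - X]mulrC mulNr.
Qed.

Lemma has_deriv_expM c x : has_deriv x (fun y => expR (c * y)) (c * expR (c * x)).
Proof.
have H : has_deriv x (fun y => c * y) c.
  have := has_deriv_mul (has_deriv_const c x) (has_deriv_var x).
  by rewrite mulr1 mulr0 addr0.
rewrite mulrC.
exact: (@is_derive1_comp R expR (fun y => c * y) x _ _ (is_derive_expR _) H).
Qed.

End Derivation.

(** Builds the derivative from the syntax of the function; its value is brought to the desired form
    afterwards through [has_deriv_eqr]. *)
Ltac derive_rules := repeat first
  [ eassumption | exact: has_deriv_const | exact: has_deriv_var
  | exact: has_deriv_expM | apply: has_deriv_opp | apply: has_deriv_add
  | apply: has_deriv_mul ].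

(** * Continuity of comparison functions on cylinders *)

Section Within.
Context {R : realType} {X : topologicalType}.
Implicit Types (A : set (X * R)) (F G : X * R -> R).

Lemma within_add A F G : {within A, continuous F} -> {within A, continuous G} ->
  {within A, continuous (fun p => F p + G p)}.
Proof. by move=> cF cG p; apply: continuousD; [exact: cF|exact: cG]. Qed.

Lemma within_sub A F G : {within A, continuous F} -> {within A, continuous G} ->
  {within A, continuous (fun p => F p - G p)}.
Proof. by move=> cF cG p; apply: continuousB; [exact: cF|exact: cG]. Qed.

Lemma within_mul A F G : {within A, continuous F} -> {within A, continuous G} ->
  {within A, continuous (fun p => F p * G p)}.
Proof. by move=> cF cG p; apply: continuousM; [exact: cF|exact: cG]. Qed.

Lemma within_fst A (h : X -> R) : continuous h ->
  {within A, continuous (fun p => h p.1)}.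
Proof.
move=> ch; apply: continuous_subspaceT => p.
by apply: cvg_comp; [exact: cvg_fst|exact: ch].
Qed.

Lemma within_snd A (h : R -> R) : continuous h ->
  {within A, continuous (fun p => h p.2)}.
Proof.
move=> ch; apply: continuous_subspaceT => p.
by apply: cvg_comp; [exact: cvg_snd|exact: ch].
Qed.

Lemma within_exp A c K : {within A, continuous (fun p => c * expR (K * p.2))}.
Proof.
apply: (within_snd (h := fun t => c * expR (K * t))) => t.
exact: has_deriv_continuous (has_deriv_mul (has_deriv_const c t) (has_deriv_expM K t)).
Qed.

End Within.

(** * Periodic even functions and their fundamental domain *)

Section Periodic.
Context {R : realType}.
Implicit Types (f : R -> R) (x : R).

Lemma periodic_int f : periodic f 1 -> forall (k : int) x, f (x + k%:~R) = f x.
Proof.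
move=> fp [] k x; first by rewrite -pmulrn periodicn.
by rewrite NegzE rmorphN /= -[in RHS](subrK k.+1%:~R x) -pmulrn periodicn.
Qed.

Lemma periodic_even f : periodic f 1 ->
  (forall x, 0 <= x <= 1 -> f x = f (1 - x)) -> forall x, f (- x) = f x.
Proof.
move=> fp fs x; pose y := x - (Num.floor x)%:~R.
have y01 : 0 <= y <= 1.
  have := floor_itv x; rewrite /y intrD => /andP[? ?]; lra.
rewrite -(periodic_int fp (Num.floor x) (- x)) -(periodic_int fp (- Num.floor x) x).
rewrite rmorphN /= -/y (_ : - x + _ = - y); last by rewrite /y; ring.
by rewrite (fs y y01) -[in LHS](fp (- y)) addrC.
Qed.

(** [[0, 1/2]] is a fundamental domain for the group generated by [x -> - x] and [x -> x + 1], under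
    which the solution is invariant. *)
Lemma fold_half x : exists y (k : int), 0 <= y <= 2^-1 /\
  (x = y + k%:~R \/ x = - y + k%:~R).
Proof.
pose y := x - (Num.floor x)%:~R.
have y01 : 0 <= y <= 1.
  have := floor_itv x; rewrite /y intrD => /andP[? ?]; lra.
have [yh|yh] := leP y 2^-1.
  exists y, (Num.floor x); split; first lra.
  by left; rewrite /y subrK.
exists (1 - y), (Num.floor x + 1); split; first lra.
by right; rewrite intrD /y; ring.
Qed.

End Periodic.

(** * Classical solutions *)

Section Solution.
Context {R : realType}.
Variables (n : nat) (f g : R -> R) (S : \bar R) (u : R -> R -> R).
Hypothesis sol : positive_classical_solution n f g S u.
Local Notation N := (n%:R - 1 : R).
Implicit Types (x y z r s t tau e m K : R).

Lemma lt_horizon (s t : R) : s <= t -> (t%:E < S)%E -> (s%:E < S)%E.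
Proof. by move=> st; apply: le_lt_trans; rewrite lee_fin. Qed.

Lemma sol_gt0 x t : 0 <= t -> (t%:E < S)%E -> 0 < u x t.
Proof. by case: sol => _ _ + _ _; apply. Qed.

Lemma sol_periodic t : 0 <= t -> (t%:E < S)%E -> periodic (u ^~ t) 1.
Proof. by case: sol => _ + _ _ _; apply. Qed.

Lemma sol_eq x t : 0 < t -> (t%:E < S)%E ->
  dt u x t = dxx u x t / ((dx u x t) ^+ 2 + 1) - N / u x t
             + f x * Num.sqrt ((dx u x t) ^+ 2 + 1).
Proof. by case: sol => _ _ _ + _; apply. Qed.

Lemma sol_init x : u x 0 = g x.
Proof. by case: sol. Qed.

Lemma sol_dx x t : 0 < t -> (t%:E < S)%E -> has_deriv x (u ^~ t) (dx u x t).
Proof.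
case: sol => [[_ [H _]] _ _ _ _] t0 tS; have [+ _ _] := H x t t0 tS.
by move=> /derivableP; rewrite /dx derive1E.
Qed.

Lemma sol_dxx x t : 0 < t -> (t%:E < S)%E ->
  has_deriv x (dx u ^~ t) (dxx u x t).
Proof.
case: sol => [[_ [H _]] _ _ _ _] t0 tS; have [_ + _] := H x t t0 tS.
by move=> /derivableP; rewrite /dxx derive1E.
Qed.

Lemma sol_dt x t : 0 < t -> (t%:E < S)%E -> has_deriv t (u x) (dt u x t).
Proof.
case: sol => [[_ [H _]] _ _ _ _] t0 tS; have [_ _] := H x t t0 tS.
by move=> /derivableP; rewrite /dt derive1E.
Qed.

Lemma horizon_nbhs t : 0 < t -> (t%:E < S)%E -> exists2 r : R, 0 < r &
  forall s, `|s - t| < r -> 0 < s /\ (s%:E < S)%E.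
Proof.
move=> t0; case: S => [T|_|//].
  rewrite lte_fin => tT; exists (Num.min t (T - t)).
    by rewrite lt_min t0 subr_gt0.
  move=> s; rewrite lt_min lte_fin ltr_norml ltr_norml.
  by move=> /andP[/andP[? ?] /andP[? ?]]; split; lra.
exists t => // s; rewrite ltr_norml => /andP[? ?]; split; first lra.
exact: ltry.
Qed.

(** The open slab is a neighbourhood of each of its points, so continuity within it is ordinary
    joint continuity. *)
Lemma dx_continuous x t : 0 < t -> (t%:E < S)%E ->
  forall e, 0 < e -> exists2 r : R, 0 < r & forall y s,
    `|y - x| < r -> `|s - t| < r -> `|dx u y s - dx u x t| <= e.
Proof.
move=> t0 tS e e0.
case: sol => [[_ [_ [_ + _ _]]] _ _ _ _] => /subspace_continuousP/(_ (x, t)).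
move=> /(_ (conj t0 tS))/cvgrPdist_le/(_ _ e0).
move=> [[B C] /= [[r1 /= r10 H1] [r2 /= r20 H2]] BC].
have [r3 r30 H3] := horizon_nbhs t0 tS.
exists (Num.min r1 (Num.min r2 r3)) => [|y s].
  by rewrite lt_min r10 lt_min r20.
rewrite lt_min => /andP[yr1 _]; rewrite lt_min => /andP[_].
rewrite lt_min => /andP[sr2 sr3].
have BCys : (B `*` C) (y, s).
  by split; [apply: H1|apply: H2]; rewrite /= distrC.
have H : `|dx u x t - dx u y s| <= e := BC _ BCys (H3 _ sr3).
by rewrite distrC.
Qed.

Lemma sol_along (xi : R -> R) t dxi : 0 < t -> (t%:E < S)%E ->
  has_deriv t xi dxi ->
  has_deriv t (fun s => u (xi s) s) (dx u (xi t) t * dxi + dt u (xi t) t).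
Proof.
move=> t0 tS Hxi; have [r r0 Hr] := horizon_nbhs t0 tS.
apply: (@has_deriv_along R u (dx u) xi t dxi (dt u (xi t) t) r r0) => //.
- by move=> y s _ /Hr[s0 sS]; exact: sol_dx.
- exact: dx_continuous.
- exact: sol_dt.
Qed.

(** The free map [xi] covers fixed, reflected, shifted and moving points at once. *)
Lemma sol_within (X : topologicalType) (A : set (X * R)) (xi : X * R -> R) :
  continuous xi -> (forall p, A p -> 0 <= p.2 /\ (p.2%:E < S)%E) ->
  {within A, continuous (fun p => u (xi p) p.2)}.
Proof.
move=> cxi HA; apply/subspace_continuousP => p Ap.
case: sol => [[/subspace_continuousP/(_ (xi p, p.2)) + _] _ _ _ _].
move=> /(_ (HA _ Ap))/cvgrPdist_le H.
apply/cvgrPdist_le => e /H [[B C] /= [nB nC] BC].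
have {}nB : \forall q \near p, B (xi q) := cxi p _ nB.
have {}nC : \forall q \near p, C q.2 := @cvg_snd _ _ _ _ _ _ nC.
rewrite near_withinE; near=> q => Aq.
have BCq : (B `*` C) (xi q, q.2) by split => /=; [near: q; exact: nB|near: q; exact: nC].
exact: (BC _ BCq (HA _ Aq)).
Unshelve. all: by end_near. Qed.

(** By periodicity a minimum over the compact set [[0, 1] x [0, tau]] is global. The bound makes the
    singular term [N / u] Lipschitz up to time [tau]. *)
Lemma sol_lbound tau : 0 <= tau -> (tau%:E < S)%E ->
  exists2 m, 0 < m & forall x t, 0 <= t <= tau -> m <= u x t.
Proof.
move=> tau0 tauS.
have [|||[x t]] := @compact_EVT_min _ R (fun p => u p.1 p.2) (`[0, 1] `*` `[0, tau]).
- by exists (0, 0); split; rewrite /= in_itv /= lexx ?ler01.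
- by apply: compact_setX; exact: segment_compact.
- apply: sol_within => [p|[y s]]; first exact: cvg_fst.
  rewrite /= !in_itv /= => -[_ /andP[? ?]]; split => //.
  exact: lt_horizon tauS.
rewrite inE /= !in_itv /= => -[_ /andP[t0 ttau]] H.
have tS := lt_horizon ttau tauS.
exists (u x t); first exact: sol_gt0.
move=> y s /andP[s0 stau]; have sS := lt_horizon stau tauS.
pose z := y - (Num.floor y)%:~R.
have z01 : 0 <= z <= 1.
  have := floor_itv y; rewrite /z intrD => /andP[? ?]; lra.
have -> : u y s = u z s.
  by rewrite -(periodic_int (sol_periodic s0 sS) (Num.floor y) z) subrK.
by apply: (H (z, s)); rewrite inE /= !in_itv /= z01 s0 stau.
Qed.

End Solution.

(** * Reflection symmetry *)

(** One-sided Lipschitz bound for the reaction term: [N / a - N / b = N (b - a) / (a b)], where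
    [b - a] may be negative. *)
Lemma reaction_le {R : realType} (N m a b D : R) : 0 <= N -> 0 < m ->
  m <= a -> m <= b -> 0 <= D -> b - a <= D -> N / a - N / b <= N / m ^+ 2 * D.
Proof.
move=> N0 m0 ma mb D0 H.
have a0 : 0 < a by exact: lt_le_trans ma.
have b0 : 0 < b by exact: lt_le_trans mb.
have -> : N / a - N / b = N * ((b - a) * (a * b)^-1) by field; rewrite !gt_eqF.
rewrite -mulrA; apply: ler_wpM2l => //; rewrite mulrC.
apply: (@le_trans _ _ ((a * b)^-1 * D)).
  by apply: ler_wpM2l => //; rewrite invr_ge0 mulr_ge0 // ltW.
apply: ler_wpM2r => //; rewrite lef_pV2 ?posrE ?mulr_gt0 ?exprn_gt0//.
by rewrite expr2; apply: ler_pM => //; exact: ltW.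
Qed.

(** [A] and [B] stand for u_xx at [x] and [- x], [q] for u_x^2 + 1, [ra] and [rb] for the reaction
    terms and [w] for the common forcing term. The [1] in [c + 1] provides the strict inequality. *)
Lemma reflected_touching {R : realType} (A B q ra rb w c D : R) :
  0 < q -> 0 <= - B + A -> ra - rb <= c * D -> 0 < D ->
  0 < (c + 1) * D - (B / q - rb + w - (A / q - ra + w)).
Proof.
move=> q0 AB rab D0.
have : B / q <= A / q by rewrite ler_pM2r ?invr_gt0//; lra.
lra.
Qed.

Section Symmetry.
Context {R : realType}.
Variables (n : nat) (f g : R -> R) (S : \bar R) (u : R -> R -> R).
Hypothesis sol : positive_classical_solution n f g S u.
Hypothesis n1 : (1 <= n)%N.
Hypothesis f_even : forall x, f (- x) = f x.
Hypothesis g_even : forall x, g (- x) = g x.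
Local Notation N := (n%:R - 1 : R).
Implicit Types (x y z r s t tau e m K d : R).

Lemma reaction_ge0 : 0 <= N.
Proof. by rewrite subr_ge0 ler1n. Qed.

(** Where [u (- x) t - u x t] first meets the margin [d * expR (K * t)], the growth rate of the
    margin beats the Lipschitz constant of the reaction term. [K] is independent of [d], which can
    therefore tend to 0. *)
Lemma sol_even_half tau : 0 <= tau -> (tau%:E < S)%E ->
  exists K, forall d x t, 0 < d -> - 2^-1 <= x <= 2^-1 -> 0 <= t <= tau ->
  u (- x) t - u x t < d * expR (K * t).
Proof.
move=> tau0 tauS; have [m m0 mu] := sol_lbound sol tau0 tauS.
pose K := N / m ^+ 2 + 1; exists K => d + + d0.
pose W x t := d * expR (K * t) - (u (- x) t - u x t).
suff H x t : `[- 2^-1, 2^-1]%classic x -> 0 <= t <= tau -> 0 < W x t.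
  by move=> x t xh tt; rewrite -subr_gt0; apply: H => //=; rewrite in_itv.
apply: (@max_principle R R `[- 2^-1, 2^-1] W 0 tau).
- exact: segment_compact.
- apply: within_sub; first exact: within_exp.
  have AS (p : R * R) : (`[- 2^-1, 2^-1]%classic `*` `[0, tau]%classic) p ->
      0 <= p.2 /\ (p.2%:E < S)%E.
    rewrite /= !in_itv /= => -[_ /andP[? ?]]; split => //; exact: lt_horizon tauS.
  apply: within_sub.
    apply: (sol_within sol (xi := fun p => - p.1)) => // p.
    by apply: cvgN; exact: cvg_fst.
  by apply: (sol_within sol (xi := fst)) => // p; exact: cvg_fst.
- by move=> y _; rewrite /W !(sol_init sol) g_even subrr subr0 mulr_gt0// expR_gt0.
move=> {}x {}t; rewrite /= in_itv /= => /andP[x1 x2] /andP[t0 ttau] Wxt Wy.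
have tS := lt_horizon ttau tauS.
have uper := sol_periodic sol (ltW t0) tS.
pose D := d * expR (K * t).
have D0 : 0 < D by rewrite mulr_gt0// expR_gt0.
(* By periodicity [W] equals [D > 0] at both endpoints, so its zero is an interior point. *)
have endpt : u (- 2^-1) t = u 2^-1 t.
  by rewrite -(uper (- 2^-1)); congr (u _ t); lra.
have {}x1 : - 2^-1 < x.
  rewrite lt_neqAle x1 andbT; apply/eqP => E; move: Wxt; rewrite /W -E opprK endpt -/D; lra.
have {}x2 : x < 2^-1.
  rewrite lt_neqAle x2 andbT; apply/eqP => E; move: Wxt; rewrite /W E endpt -/D; lra.
pose r := Num.min (x + 2^-1) (2^-1 - x).
have r0 : 0 < r by rewrite lt_min; apply/andP; split; lra.
have r1 : r <= x + 2^-1 by rewrite ge_min lexx.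
have r2 : r <= 2^-1 - x by rewrite ge_min lexx orbT.
have Wmin y : x - r < y < x + r -> W x t <= W y t.
  by move=> yr; rewrite Wxt; apply: Wy; rewrite /= in_itv /=; lra.
have dW y : has_deriv y (W ^~ t) (dx u (- y) t + dx u y t).
  have := sol_dx sol y t0 tS; have := has_deriv_refl (sol_dx sol (- y) t0 tS) => H1 H2.
  rewrite (_ : _ + _ = 0 - (- dx u (- y) t - dx u y t)); last by rewrite sub0r opprB opprK addrC.
  by rewrite /W; derive_rules.
have ddW : has_deriv x (fun y => dx u (- y) t + dx u y t) (- dxx u (- x) t + dxx u x t).
  have := sol_dxx sol x t0 tS; have := has_deriv_refl (sol_dxx sol (- x) t0 tS) => H1 H2.
  by derive_rules.
have p0 : dx u (- x) t + dx u x t = 0.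
  apply/eqP; rewrite eq_le; apply/andP; split.
    by apply: (has_deriv_le0_left r0 (dW x)) => y yr; apply: Wmin; lra.
  by apply: (has_deriv_ge0_right r0 (dW x)) => y yr; apply: Wmin; lra.
have pp0 : 0 <= - dxx u (- x) t + dxx u x t.
  apply: (has_deriv2_ge0_right r0 (fun y _ => dW y) ddW p0) => y yr.
  by apply: Wmin; lra.
exists (K * D - (dt u (- x) t - dt u x t)).
  have := sol_dt sol (- x) t0 tS; have := sol_dt sol x t0 tS => H1 H2.
  rewrite /W; apply: has_deriv_add; last by derive_rules.
  apply: has_deriv_eqr (has_deriv_mul (has_deriv_const d t) (has_deriv_expM K t)) _.
  by rewrite mulr0 addr0 mulrCA.
have pE : dx u (- x) t = - dx u x t by apply/eqP; rewrite -addr_eq0 p0.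
rewrite (sol_eq sol x t0 tS) (sol_eq sol (- x) t0 tS) f_even pE sqrrN.
apply: reflected_touching => //; first by rewrite ltr_wpDl// sqr_ge0.
apply: reaction_le => //; first exact: reaction_ge0.
- by apply: mu; rewrite (ltW t0).
- by apply: mu; rewrite (ltW t0).
- exact: ltW.
by move/eqP: Wxt; rewrite /W -/D subr_eq0 => /eqP ->.
Qed.

Lemma sol_even x t : 0 <= t -> (t%:E < S)%E -> u (- x) t = u x t.
Proof.
move=> t0 tS; have uper := sol_periodic sol t0 tS.
have le y : - 2^-1 <= y <= 2^-1 -> u (- y) t <= u y t.
  move=> yh; have [K HK] := sol_even_half t0 tS.
  rewrite -subr_le0; apply/ler_addgt0Pr => e e0; rewrite add0r.
  have E0 := expR_gt0 (K * t).
  have := HK (e / expR (K * t)) y t; rewrite divr_gt0// divfK ?gt_eqF//.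
  by move=> /(_ isT yh); rewrite lexx t0 => /(_ isT)/ltW.
have eq y : - 2^-1 <= y <= 2^-1 -> u (- y) t = u y t.
  move=> yh; apply/eqP; rewrite eq_le le//= -[y in u y t]opprK le//; lra.
have [y [k [y01 [->|->]]]] := fold_half x.
  rewrite opprD -rmorphN (periodic_int uper) (periodic_int uper) eq//; lra.
rewrite opprD -rmorphN (periodic_int uper) (periodic_int uper) eq//; lra.
Qed.

End Symmetry.

(** * The two-point comparison *)

Section Bump.
Context {R : realType}.
Implicit Types (z : R).

(** Vanishes to second order at 0 and 1, so its derivative vanishes there too; [step] below is its
    primitive with value 0 at 0. *)
Definition bump z : R := (z * (1 - z)) ^+ 2.
Definition bump' z : R := 2 * (z * (1 - z)) * (1 - 2 * z).
Definition step z : R := z ^+ 3 / 3 - z ^+ 4 / 2 + z ^+ 5 / 5.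

Lemma has_deriv_step z : has_deriv z step (bump z).
Proof.
have H : has_deriv z (fun y : R => y * y * y * (3^-1 - y / 2 + y * y / 5)) (bump z).
  apply: has_deriv_eqr; first by derive_rules.
  by rewrite /bump; field.
apply: has_deriv_eqr; last reflexivity.
rewrite (_ : step = fun y : R => y * y * y * (3^-1 - y / 2 + y * y / 5)) //.
by apply/funext => y; rewrite /step; field.
Qed.

Lemma has_deriv_bump z : has_deriv z bump (bump' z).
Proof.
rewrite (_ : bump = fun y : R => (y * (1 - y)) * (y * (1 - y))) //.
apply: has_deriv_eqr; first by derive_rules.
by rewrite /bump'; ring.
Qed.

Lemma has_deriv_bump' z : has_deriv z bump' (2 - 12 * (z * (1 - z))).
Proof.
rewrite /bump'; apply: has_deriv_eqr; first by derive_rules.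
by rewrite /=; ring.
Qed.

Lemma bump_ge0 z : 0 <= bump z.
Proof. exact: sqr_ge0. Qed.

Lemma bump_le1 z : 0 <= z <= 1 -> bump z <= 1.
Proof.
by move=> z01; rewrite /bump exprn_ile1//; [apply: mulr_ge0; lra|apply: mulr_ile1; lra].
Qed.

Lemma step_incr_le z1 z2 : 0 <= z1 -> z1 <= z2 -> z2 <= 1 ->
  0 <= step z2 - step z1 <= z2 - z1.
Proof.
move=> z10; rewrite le_eqVlt => /orP[/eqP->|z12] z21; first by rewrite !subrr lexx.
have [c c12 ->] := mvt z12 (fun z _ => has_deriv_step z).
rewrite mulr_ge0 ?bump_ge0//= ?ler_piMl// ?bump_le1//; lra.
Qed.

(* In the coordinate z of the interval [q - l, q], where C_x = E bump z / l: the
   curvature of C, minus the transport due to the moving left end, minus C_t; the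
   last term absorbs the forcing. *)
Definition profile (E l sg lam th z : R) : R :=
  E * bump' z / l ^+ 2 / ((E * bump z / l) ^+ 2 + 1)
  - sg * (1 - z) * (E * bump z / l) + lam * E * step z
  + th * (E * bump z / l) ^+ 2 / 2.

Lemma ler_norm_prod1 (a b : R) : `|a| <= 1 -> `|b| <= 1 -> `|a * b| <= 1.
Proof. by move=> a1 b1; rewrite normrM; apply: mulr_ile1. Qed.

(* The expression is at least (1 - A w / 2)^2 for A = 20 + 3 sg + 2 F. *)
Lemma slope_bracket_ge0 (a w v y et l lam sg th F : R) :
  0 <= w <= 4^-1 -> -1 <= v <= 1 -> 2^-1 <= a <= 1 -> 0 <= et <= 1 ->
  0 < l <= 1 -> 0 <= y <= 1 -> 0 <= sg -> 0 <= th <= F ->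
  (20 + 3 * sg + 2 * F) ^+ 2 <= 4 * lam * l ^+ 2 ->
  0 <= (2 - 12 * w) * a
    - 8 * (et ^+ 2 * w ^+ 3 * v ^+ 2 * a ^+ 2) * w + lam * l ^+ 2 * w ^+ 2
    + sg * l * w ^+ 2
    - 2 * (l * (1 - y) * v) * (sg * w) + 2 * (l * et * w ^+ 2 * v) * (th * w).
Proof.
move=> /andP[w0 w1] v1 a1 et1 /andP[l0 l1] y1 sg0 /andP[th0 thF] hA.
have nw : `|w| <= 1 by rewrite ger0_norm //; lra.
have nv : `|v| <= 1 by rewrite ler_norml; lra.
have na : `|a| <= 1 by rewrite ger0_norm; lra.
have ne : `|et| <= 1 by rewrite ger0_norm; lra.
have nl : `|l| <= 1 by rewrite ger0_norm; lra.
have ny : `|1 - y| <= 1 by rewrite ger0_norm; lra.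
have nX (k : nat) (b : R) : `|b| <= 1 -> `|b ^+ k| <= 1.
  by move=> b1; rewrite normrX exprn_ile1.
have le1 (b c : R) : `|b| <= 1 -> 0 <= c -> - c <= b * c <= c.
  move=> + c0; rewrite ler_norml => /andP[b1 b2]; apply/andP; split.
    by rewrite -mulN1r; apply: ler_wpM2r.
  by apply: ler_piMl.
(* Each term is replaced by a bound in [w] alone. The negative linear terms have coefficients 12, 8,
   [2 * sg] and [2 * F], whose sum is at most [20 + 3 * sg + 2 * F]. *)
have t1 : 1 - 12 * w <= (2 - 12 * w) * a.
  have := ler_wpM2l w0 (proj2 (andP a1)); move: (proj1 (andP a1)).
  rewrite mulr1 mulrBl -mulrA; set p := w * a; lra.
have t2 : (et ^+ 2 * w ^+ 3 * v ^+ 2 * a ^+ 2) * w <= w.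
  by apply: (proj2 (andP (le1 _ _ _ w0))); rewrite !ler_norm_prod1 ?nX.
have t3 : (20 + 3 * sg + 2 * F) ^+ 2 * w ^+ 2 <= 4 * lam * l ^+ 2 * w ^+ 2.
  by apply: ler_wpM2r => //; exact: sqr_ge0.
have t4 : 0 <= sg * l * w ^+ 2.
  by apply: mulr_ge0; [apply: mulr_ge0 => //; exact: ltW|exact: sqr_ge0].
have sw0 : 0 <= sg * w by exact: mulr_ge0.
have t5 : (l * (1 - y) * v) * (sg * w) <= sg * w.
  by apply: (proj2 (andP (le1 _ _ _ sw0))); rewrite !ler_norm_prod1.
have tw0 : 0 <= th * w by exact: mulr_ge0.
have t6 : - (th * w) <= (l * et * w ^+ 2 * v) * (th * w).
  by apply: (proj1 (andP (le1 _ _ _ tw0))); rewrite !ler_norm_prod1 ?nX.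
have t7 : th * w <= F * w by exact: ler_wpM2r.
have t8 : 0 <= (1 - (20 + 3 * sg + 2 * F) * w / 2) ^+ 2 by exact: sqr_ge0.
move: t1 t2 t3 t4 t5 t6 t7 t8 sw0; clear.
set P := et ^+ 2 * w ^+ 3 * v ^+ 2 * a ^+ 2.
set P5 := l * (1 - y) * v; set P6 := l * et * w ^+ 2 * v.
move: P P5 P6 => P P5 P6; lra.
Qed.

(** The derivative of [profile] is [E / l ^+ 2] times the expression of [slope_bracket_ge0]. The
    condition [E <= l] keeps the slope [E * bump z / l] between 0 and 1. *)
Lemma bump_subsolution (E l sg lam F th z1 z2 : R) :
  0 <= E -> 0 < l <= 1 -> E <= l -> 0 <= sg -> 0 <= th <= F ->
  (20 + 3 * sg + 2 * F) ^+ 2 <= 4 * lam * l ^+ 2 ->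
  0 <= z1 -> z1 <= z2 -> z2 <= 1 ->
  profile E l sg lam th z1 <= profile E l sg lam th z2.
Proof.
move=> E0 /andP[l0 l1] El sg0 /andP[th0 thF] hlam z10 + z21.
rewrite le_eqVlt => /orP[/eqP->//|z12].
pose H := profile E l sg lam th.
pose c z := E * bump z / l.
pose c' z := E * bump' z / l.
pose H' z := E / l ^+ 2 * (2 - 12 * (z * (1 - z))) / (c z ^+ 2 + 1)
  - E * bump' z / l ^+ 2 * (2 * c z * c' z) / (c z ^+ 2 + 1) ^+ 2
  + sg * c z - sg * (1 - z) * c' z + lam * E * bump z + th * c z * c' z.
have c1 z : c z ^+ 2 + 1 != 0 by rewrite gt_eqF// ltr_wpDl// sqr_ge0.
have dc z : has_deriv z c (c' z).
  have := has_deriv_bump z => db.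
  rewrite /c; apply: has_deriv_eqr; first by derive_rules.
  by rewrite /= /c'; ring.
have dH z : has_deriv z H (H' z).
  have db := has_deriv_bump z; have db' := has_deriv_bump' z.
  have ds := has_deriv_step z; have dcz := dc z.
  have dc2 : has_deriv z (fun y => c y ^+ 2 + 1) (2 * c z * c' z).
    rewrite (_ : (fun y => _) = fun y => c y * c y + 1).
      by apply: has_deriv_eqr; [derive_rules|rewrite /=; ring].
    by apply/funext => y; rewrite expr2.
  have dic := @has_deriv_inv _ (fun y => c y ^+ 2 + 1) z _ (c1 z) dc2.
  rewrite (_ : H = fun z => E * bump' z * (l ^+ 2)^-1 * (c z ^+ 2 + 1)^-1 + - (sg * (1 + - z) * c z)
     + lam * E * step z + th * (c z * c z) * 2^-1); last by [].
  apply: has_deriv_eqr; first by derive_rules.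
  rewrite /= /H'; field.
  by rewrite c1 gt_eqF.
have [y y12 E12] := mvt z12 (fun z _ => dH z).
rewrite -subr_ge0 E12 mulr_ge0// ?subr_ge0 ?(ltW z12)//.
(* In these variables [bump y] is [w ^+ 2], [bump' y] is [2 * w * v] and the slope [c y] is
   [et * w ^+ 2]. *)
pose w := y * (1 - y); pose v := 1 - 2 * y; pose et := E / l.
pose a := (c y ^+ 2 + 1)^-1.
have et01 : 0 <= et <= 1.
  by rewrite /et divr_ge0 ?(ltW l0)//= ler_pdivrMr// mul1r.
have w0 : 0 <= w by apply: mulr_ge0; lra.
have w1 : w <= 4^-1.
  have : 0 <= (1 - 2 * y) ^+ 2 by exact: sqr_ge0.
  rewrite /w expr2; lra.
have c01 : 0 <= c y <= 1.
  have -> : c y = et * w ^+ 2 by rewrite /c /et /bump -/w; ring.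
  have ? : 0 <= w ^+ 2 <= 1 by rewrite exprn_ge0//= exprn_ile1//; lra.
  by apply/andP; split; [apply: mulr_ge0; lra|apply: mulr_ile1; lra].
have q0 : 0 < c y ^+ 2 + 1 by rewrite ltr_wpDl// sqr_ge0.
have a01 : 2^-1 <= a <= 1.
  have ? : 0 <= c y ^+ 2 <= 1 by rewrite exprn_ge0 ?exprn_ile1//; lra.
  rewrite /a lef_pV2 ?posrE// invf_le1//; lra.
have E1 : H' y = E / l ^+ 2 * ((2 - 12 * w) * a
    - 8 * (et ^+ 2 * w ^+ 3 * v ^+ 2 * a ^+ 2) * w + lam * l ^+ 2 * w ^+ 2
    + sg * l * w ^+ 2
    - 2 * (l * (1 - y) * v) * (sg * w) + 2 * (l * et * w ^+ 2 * v) * (th * w)).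
  rewrite /H' -[((c y ^+ 2 + 1) ^+ 2)^-1]exprVn -/a /c' /bump /bump' -/w -/v /c /bump -/w /et.
  by field; rewrite gt_eqF.
rewrite E1 mulr_ge0 ?divr_ge0 ?exprn_ge0 ?(ltW l0)//.
apply: (slope_bracket_ge0 _ _ _ _ _ _ _ _ hlam) => //.
- by rewrite w0.
- by rewrite /v; lra.
- by rewrite l0.
- by lra.
- by rewrite th0.
Qed.

End Bump.

(** For p >= q >= 1, (p - q)(p + q - 2) >= 0 gives p - q <= (p^2 - q^2) / 2. This replaces the
    square root by the quadratic term of [profile]. *)
Lemma sqrt_diff_le {R : realType} (a b : R) : 0 <= b -> b <= a ->
  Num.sqrt (a ^+ 2 + 1) - Num.sqrt (b ^+ 2 + 1) <= (a ^+ 2 - b ^+ 2) / 2.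
Proof.
move=> b0 ba.
have s1 (c : R) : 1 <= Num.sqrt (c ^+ 2 + 1) /\ Num.sqrt (c ^+ 2 + 1) ^+ 2 = c ^+ 2 + 1.
  have c0 := sqr_ge0 c; split; last by rewrite sqr_sqrtr// addr_ge0.
  by rewrite -[leLHS]sqrtr1 ler_sqrt ?lerDr// addr_ge0.
have [a1 aE] := s1 a; have [b1 bE] := s1 b.
have sab : Num.sqrt (b ^+ 2 + 1) <= Num.sqrt (a ^+ 2 + 1).
  have ab2 : b ^+ 2 <= a ^+ 2 by rewrite lerXn2r ?nnegrE//; exact: le_trans ba.
  by rewrite ler_sqrt ?lerD2r// addr_ge0 ?sqr_ge0.
have -> : a ^+ 2 - b ^+ 2 = Num.sqrt (a ^+ 2 + 1) ^+ 2 - Num.sqrt (b ^+ 2 + 1) ^+ 2.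
  by rewrite aE bE; ring.
move: a1 b1 sab; set p := Num.sqrt (a ^+ 2 + 1); set q := Num.sqrt (b ^+ 2 + 1).
move=> p1 q1 qp; have : 0 <= (p - q) * (p + q - 2) by apply: mulr_ge0; lra.
rewrite !expr2; lra.
Qed.

(** If the slope is larger at the second point, the difference of the forcing terms has the right
    sign and [th = 0] serves; otherwise [th = f1]. *)
Lemma forcing_le {R : realType} (F f1 f2 c1 c2 : R) :
  0 <= f1 <= F -> f1 <= f2 -> 0 <= c1 -> 0 <= c2 ->
  exists2 th, 0 <= th <= F & f1 * Num.sqrt (c1 ^+ 2 + 1) - f2 * Num.sqrt (c2 ^+ 2 + 1)
     <= th * c1 ^+ 2 / 2 - th * c2 ^+ 2 / 2.
Proof.
move=> /andP[f10 f1F] f12 c10 c20.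
have fs : f1 * Num.sqrt (c2 ^+ 2 + 1) <= f2 * Num.sqrt (c2 ^+ 2 + 1).
  by apply: ler_wpM2r => //; exact: sqrtr_ge0.
have [c12|/ltW c21] := leP c1 c2.
  exists 0; first by rewrite lexx (le_trans f10).
  rewrite !mul0r subr0 subr_le0; apply: le_trans fs; apply: ler_wpM2l => //.
  have ab2 : c1 ^+ 2 <= c2 ^+ 2 by rewrite lerXn2r ?nnegrE.
  by rewrite ler_sqrt ?lerD2r// addr_ge0 ?sqr_ge0.
exists f1; first by rewrite f10.
have := ler_wpM2l f10 (sqrt_diff_le c20 c21).
rewrite mulrBr mulrA mulrBr mulrBl; lra.
Qed.

(** The sign of the time derivative at a touching point, with [U1] and [U2] standing for u_xx at the
    two points and [c] for the slopes there. Diffusion, transport and the decay of the bump combine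
    into a difference of values of [profile]. *)
Lemma two_point_touching {R : realType}
    (N m u1 u2 D E l sg lam F z1 z2 U1 U2 f1 f2 : R) :
  let c z := E * bump z / l in
  0 <= N -> 0 < m -> m <= u1 -> m <= u2 -> 0 < D -> u1 - u2 <= D ->
  0 <= E -> 0 < l <= 1 -> E <= l -> 0 <= sg ->
  (20 + 3 * sg + 2 * F) ^+ 2 <= 4 * lam * l ^+ 2 ->
  0 <= z1 -> z1 <= z2 -> z2 <= 1 ->
  0 <= f1 <= F -> f1 <= f2 ->
  U1 <= E * bump' z1 / l ^+ 2 -> E * bump' z2 / l ^+ 2 <= U2 ->
  0 < (N / m ^+ 2 + 1) * D
    + (c z2 * - ((1 - z2) * sg)
        + (U2 / (c z2 ^+ 2 + 1) - N / u2 + f2 * Num.sqrt (c z2 ^+ 2 + 1)))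
    - (c z1 * - ((1 - z1) * sg)
        + (U1 / (c z1 ^+ 2 + 1) - N / u1 + f1 * Num.sqrt (c z1 ^+ 2 + 1)))
    - - (lam * E) * (step z2 - step z1).
Proof.
move=> c N0 m0 mu1 mu2 D0 u12 E0 l01 El sg0 hlam z10 z12 z21 f1F f12 U1E U2E.
have l0 : 0 < l by case/andP: l01.
have c0 z : 0 <= c z by rewrite /c; apply: divr_ge0 (ltW l0); exact: mulr_ge0 (bump_ge0 z).
have q0 z : 0 < c z ^+ 2 + 1 by rewrite ltr_wpDl// sqr_ge0.
have [th thF fc] := forcing_le f1F f12 (c0 z1) (c0 z2).
have := bump_subsolution E0 l01 El sg0 thF hlam z10 z12 z21.
have := reaction_le N0 m0 mu2 mu1 (ltW D0) u12.
have : U1 / (c z1 ^+ 2 + 1) <= E * bump' z1 / l ^+ 2 / (c z1 ^+ 2 + 1).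
  by rewrite ler_pM2r ?invr_gt0.
have : E * bump' z2 / l ^+ 2 / (c z2 ^+ 2 + 1) <= U2 / (c z2 ^+ 2 + 1).
  by rewrite ler_pM2r ?invr_gt0.
move: fc; rewrite /profile -!/(c _).
move: (E * bump' z1 / l ^+ 2 / _) (E * bump' z2 / l ^+ 2 / _) => b1 b2.
move: (U1 / _) (U2 / _) (N / u1) (N / u2) => v1 v2 r1 r2.
set s1 := Num.sqrt (c z1 ^+ 2 + 1); set s2 := Num.sqrt (c z2 ^+ 2 + 1).
move: s1 s2 (c z1) (c z2) (step z1) (step z2) => s1 s2 p1 p2 st1 st2.
move: (N / m ^+ 2) D0; clear; move=> k D0; lra.
Qed.

(** * The maximum principle on pairs of moving points *)

Section TwoPoint.
Context {R : realType}.
Variables (n : nat) (f g : R -> R) (S : \bar R) (u : R -> R -> R).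
Hypothesis sol : positive_classical_solution n f g S u.
Hypothesis n1 : (1 <= n)%N.
Hypothesis f_gt0 : forall x, 0 < f x.
Hypothesis f_le : forall x y, 0 <= x -> x <= y -> y <= 2^-1 -> f x <= f y.
Local Notation N := (n%:R - 1 : R).
Implicit Types (x y z r s t tau e m K d : R).

Lemma triangle_compact : compact [set p : R * R | 0 <= p.1 /\ p.1 <= p.2 /\ p.2 <= 1].
Proof.
have -> : [set p : R * R | 0 <= p.1 /\ p.1 <= p.2 /\ p.2 <= 1] =
   (`[0, 1] `*` `[0, 1]) `&` ((fun p : R * R => p.2 - p.1) @^-1` [set y | 0 <= y]).
  apply/seteqP; split => -[x y] /=; rewrite !in_itv /= subr_ge0.
    by move=> [x0 [xy y1]]; rewrite x0 y1 (le_trans xy y1) (le_trans x0 xy).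
  by move=> [[/andP[x0 _] /andP[_ y1]] xy].
apply: compact_closedI; first by apply: compact_setX; exact: segment_compact.
apply: closed_comp; last exact: closed_ge.
by move=> p _; apply: cvgB; [exact: cvg_snd|exact: cvg_fst].
Qed.

(* The two points move with the interval [q - (l0 + sg t), q], of which z is
   the relative coordinate. *)
Definition moving_point (q l0 sg z t : R) : R := q - (1 - z) * (l0 + sg * t).

Lemma has_deriv_moving_point_space q l0 sg z t :
  has_deriv z (moving_point q l0 sg ^~ t) (l0 + sg * t).
Proof.
rewrite /moving_point; apply: has_deriv_eqr; first by derive_rules.
by rewrite /=; ring.
Qed.

Lemma has_deriv_moving_point_time q l0 sg z t :
  has_deriv t (moving_point q l0 sg z) (- ((1 - z) * sg)).
Proof.
rewrite /moving_point; apply: has_deriv_eqr; first by derive_rules.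
by rewrite /=; ring.
Qed.

Lemma has_deriv_comp (h k : R -> R) z a b : has_deriv (k z) h a -> has_deriv z k b ->
  has_deriv z (fun y => h (k y)) (a * b).
Proof. exact: is_derive1_comp. Qed.

Lemma continuous_moving_point q l0 sg (P : topologicalType) (h k : P -> R) :
  continuous h -> continuous k ->
  continuous (fun p => moving_point q l0 sg (h p) (k p)).
Proof.
move=> ch ck p; apply: cvgB; first exact: cvg_cst.
apply: cvgM; first by apply: cvgB; [exact: cvg_cst|exact: ch].
apply: cvgD; first exact: cvg_cst.
by apply: cvgM; [exact: cvg_cst|exact: ck].
Qed.

(** The maximum principle in the relative coordinates [(z1, z2)], which keep the domain fixed while
    the interval grows. The amplitude of the bump decays at rate [lam], and [d * expR (K * t)]
    absorbs the reaction term. *)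
Lemma two_point_strict (q l0 sg ep lam F tau : R) :
  0 <= tau -> (tau%:E < S)%E ->
  0 < l0 -> 0 <= sg -> 0 <= ep <= l0 -> 0 <= lam ->
  l0 + sg * tau <= q -> q <= 2^-1 -> f 2^-1 <= F ->
  (20 + 3 * sg + 2 * F) ^+ 2 <= 4 * lam * l0 ^+ 2 ->
  (forall t, 0 < t <= tau -> 0 <= dx u (q - (l0 + sg * t)) t /\ 0 <= dx u q t) ->
  (forall z1 z2, 0 <= z1 -> z1 <= z2 -> z2 <= 1 ->
     ep * (step z2 - step z1) <= g (q - (1 - z2) * l0) - g (q - (1 - z1) * l0)) ->
  exists K, forall d z1 z2 t, 0 < d -> 0 <= z1 -> z1 <= z2 -> z2 <= 1 ->
    0 <= t <= tau ->
    0 < d * expR (K * t) + u (moving_point q l0 sg z2 t) t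
      - u (moving_point q l0 sg z1 t) t
      - ep * expR (- lam * t) * (step z2 - step z1).
Proof.
move=> tau0 tauS l00 sg0 /andP[ep0 epl] lam0 lq qh fF hlam bdry init.
have [m m0 mu] := sol_lbound sol tau0 tauS.
pose K := N / m ^+ 2 + 1; exists K => d z1 z2 t d0 z10 z12 z21 tt.
pose X := moving_point q l0 sg.
pose W (p : R * R) t := d * expR (K * t) + u (X p.2 t) t - u (X p.1 t) t
   - ep * expR (- lam * t) * (step p.2 - step p.1).
pose T := [set p : R * R | 0 <= p.1 /\ p.1 <= p.2 /\ p.2 <= 1].
suff H p s : T p -> 0 <= s <= tau -> 0 < W p s by exact: (H (z1, z2)).
move: p s {z1 z2 t z10 z12 z21 tt}; apply: (@max_principle R _ T W 0 tau).
- exact: triangle_compact.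
- have AS (p : R * R * R) : (T `*` `[0, tau]%classic) p -> 0 <= p.2 /\ (p.2%:E < S)%E.
    by rewrite /= in_itv /= => -[_ /andP[? ?]]; split => //; exact: lt_horizon tauS.
  have cstep : continuous (step : R -> R).
    by move=> z; exact: has_deriv_continuous (has_deriv_step z).
  apply: within_sub.
    apply: within_sub; first apply: within_add.
    + exact: within_exp.
    + apply: (sol_within sol (xi := fun p => X p.1.2 p.2)) => //.
      apply: continuous_moving_point => p; last exact: cvg_snd.
      by apply: cvg_comp; [exact: cvg_fst|exact: cvg_snd].
    + apply: (sol_within sol (xi := fun p => X p.1.1 p.2)) => //.
      apply: continuous_moving_point => p; last exact: cvg_snd.
      by apply: cvg_comp; [exact: cvg_fst|exact: cvg_fst].
  apply: within_mul; first exact: within_exp.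
  apply: (within_fst (h := fun p : R * R => step p.2 - step p.1)) => p.
  apply: cvgB.
    by apply: cvg_comp; [exact: cvg_snd|exact: cstep].
  by apply: cvg_comp; [exact: cvg_fst|exact: cstep].
- move=> [z1 z2] [/= z10 [z12 z21]].
  rewrite /W /X /moving_point /= !(sol_init sol) !mulr0 addr0 expR0 !mulr1.
  have := init z1 z2 z10 z12 z21; lra.
move=> [z1 z2] t [/= z10 [z12 z21]] /andP[t0 ttau] Wt Wmin.
have tS := lt_horizon ttau tauS.
set l := l0 + sg * t.
have sgt : 0 <= sg * t by rewrite mulr_ge0// ltW.
have ll0 : l0 <= l by rewrite lerDl.
have lpos : 0 < l by exact: lt_le_trans ll0.
have llq : l <= q by apply: le_trans lq; rewrite lerD2l ler_wpM2l.
have X_le z z' : z <= z' -> X z t <= X z' t.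
  move=> zz'; rewrite /X /moving_point -/l lerD2l lerN2 ler_pM2r// lerD2l lerN2.
  exact: zz'.
have X0 z : 0 <= z -> 0 <= X z t.
  move=> z0; apply: le_trans (X_le _ _ z0).
  by rewrite /X /moving_point subr0 mul1r subr_ge0.
have X1 z : z <= 1 -> X z t <= 2^-1.
  by move=> z1'; apply: le_trans (X_le _ _ z1') _; rewrite /X /moving_point subrr mul0r subr0.
(* On the diagonal [W] is the positive margin [d * expR (K * t)]. *)
have {}z12 : z1 < z2.
  rewrite lt_neqAle z12 andbT; apply/eqP => E; move: Wt; rewrite /W /= E !subrr mulr0 subr0.
  have := expR_gt0 (K * t) => e0 e1.
  have : 0 < d * expR (K * t) by rewrite mulr_gt0.
  by move: e1; rewrite addrK => ->; rewrite ltxx.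
pose E := ep * expR (- lam * t).
have E0 : 0 <= E by rewrite mulr_ge0// expR_ge0.
have El : E <= l.
  apply: le_trans ll0; apply: le_trans epl; apply: ler_piMr => //.
  by rewrite -expR0 ler_expR mulNr oppr_le0 mulr_ge0// ltW.
have dW1 z : has_deriv z (fun y => W (y, z2) t) (- (dx u (X z t) t * l) + E * bump z).
  have h1 := @has_deriv_comp (u ^~ t) (X ^~ t) z _ _
    (sol_dx sol (X z t) t0 tS) (has_deriv_moving_point_space q l0 sg z t).
  have h2 := has_deriv_step z.
  rewrite /W /=; apply: has_deriv_eqr; first by derive_rules.
  by rewrite /= /E /l; ring.
have ddW1 : has_deriv z1 (fun z => - (dx u (X z t) t * l) + E * bump z)
   (- (dxx u (X z1 t) t * l * l) + E * bump' z1).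
  have h1 := @has_deriv_comp (dx u ^~ t) (X ^~ t) z1 _ _
    (sol_dxx sol (X z1 t) t0 tS) (has_deriv_moving_point_space q l0 sg z1 t).
  have h2 := has_deriv_bump z1.
  apply: has_deriv_eqr; first by derive_rules.
  by rewrite /= /l; ring.
have dW2 z : has_deriv z (fun y => W (z1, y) t) (dx u (X z t) t * l - E * bump z).
  have h1 := @has_deriv_comp (u ^~ t) (X ^~ t) z _ _
    (sol_dx sol (X z t) t0 tS) (has_deriv_moving_point_space q l0 sg z t).
  have h2 := has_deriv_step z.
  rewrite /W /=; apply: has_deriv_eqr; first by derive_rules.
  by rewrite /= /E /l; ring.
have ddW2 : has_deriv z2 (fun z => dx u (X z t) t * l - E * bump z)
   (dxx u (X z2 t) t * l * l - E * bump' z2).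
  have h1 := @has_deriv_comp (dx u ^~ t) (X ^~ t) z2 _ _
    (sol_dxx sol (X z2 t) t0 tS) (has_deriv_moving_point_space q l0 sg z2 t).
  have h2 := has_deriv_bump z2.
  apply: has_deriv_eqr; first by derive_rules.
  by rewrite /= /l; ring.
have W1 y : 0 <= y -> y < z2 -> W (z1, z2) t <= W (y, z2) t.
  by move=> y0 yz; rewrite Wt; apply: Wmin; split => //=; split => //; exact: ltW.
have W2 y : z1 < y -> y <= 1 -> W (z1, z2) t <= W (z1, y) t.
  by move=> y0 yz; rewrite Wt; apply: Wmin; split => //=; split => //; exact: ltW.
have [bd1 bd2] := bdry t ltac:(by rewrite t0).
have bumpr z : (z == 0) || (z == 1) -> bump z = 0.
  by rewrite /bump => /orP[/eqP->|/eqP->]; rewrite ?mul0r ?subrr ?mulr0 expr0n.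
have p1 : - (dx u (X z1 t) t * l) + E * bump z1 = 0.
  apply/eqP; rewrite eq_le; apply/andP; split; last first.
    apply: (@has_deriv_ge0_right _ (fun y => W (y, z2) t) z1 _ (z2 - z1) _ (dW1 z1)) => [|y].
      by rewrite subr_gt0.
    by rewrite subrKC => /andP[zy yz]; apply: W1 yz; apply: le_trans (ltW zy).
  (* At [z1 = 0] there is no room on the left; the missing inequality is u_x >= 0 at the left end,
     since [bump 0 = 0]. The case [z2 = 1] below is symmetric. *)
  have /orP[/eqP z1E|z1g] : (0 == z1) || (0 < z1) by rewrite -le_eqVlt.
    rewrite -z1E (bumpr 0) ?eqxx// mulr0 addr0 oppr_le0 mulr_ge0 ?(ltW lpos)//.
    by rewrite /X /moving_point subr0 mul1r.
  apply: (@has_deriv_le0_left _ (fun y => W (y, z2) t) z1 _ z1 z1g (dW1 z1)) => y.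
  by rewrite subrr => /andP[y0 yz]; apply: W1 (ltW y0) (lt_trans yz z12).
have p2 : dx u (X z2 t) t * l - E * bump z2 = 0.
  apply/eqP; rewrite eq_le; apply/andP; split.
    apply: (@has_deriv_le0_left _ (fun y => W (z1, y) t) z2 _ (z2 - z1) _ (dW2 z2)) => [|y].
      by rewrite subr_gt0.
    by rewrite subKr => /andP[zy yz]; apply: W2 zy (le_trans (ltW yz) z21).
  have /orP[/eqP z2E|z2l] : (z2 == 1) || (z2 < 1) by rewrite -le_eqVlt.
    rewrite z2E (bumpr 1) ?eqxx ?orbT// mulr0 subr0 mulr_ge0 ?(ltW lpos)//.
    by rewrite /X /moving_point subrr mul0r subr0.
  apply: (@has_deriv_ge0_right _ (fun y => W (z1, y) t) z2 _ (1 - z2) _ (dW2 z2)) => [|y].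
    by rewrite subr_gt0.
  by rewrite subrKC => /andP[zy yz]; apply: W2 (lt_trans z12 zy) (ltW yz).
have q1 : 0 <= - (dxx u (X z1 t) t * l * l) + E * bump' z1.
  apply: (@has_deriv2_ge0_right _ (fun y => W (y, z2) t) _ z1 _ (z2 - z1) _
    (fun y _ => dW1 y) ddW1 p1) => [|y].
    by rewrite subr_gt0.
  by rewrite subrKC => /andP[zy yz]; apply: W1 yz; apply: le_trans (ltW zy).
have q2 : 0 <= dxx u (X z2 t) t * l * l - E * bump' z2.
  apply: (@has_deriv2_ge0_left _ (fun y => W (z1, y) t) _ z2 _ (z2 - z1) _
    (fun y _ => dW2 y) ddW2 p2) => [|y].
    by rewrite subr_gt0.
  by rewrite subKr => /andP[zy yz]; apply: W2 zy (le_trans (ltW yz) z21).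
have slope z : dx u (X z t) t * l = E * bump z -> dx u (X z t) t = E * bump z / l.
  by move=> <-; rewrite mulfK// gt_eqF.
have {}p1 : dx u (X z1 t) t = E * bump z1 / l.
  by apply: slope; apply/eqP; rewrite eq_sym -subr_eq0 addrC p1.
have {}p2 : dx u (X z2 t) t = E * bump z2 / l.
  by apply: slope; apply/eqP; rewrite -subr_eq0 p2.
exists (K * (d * expR (K * t))
    + (dx u (X z2 t) t * - ((1 - z2) * sg) + dt u (X z2 t) t)
    - (dx u (X z1 t) t * - ((1 - z1) * sg) + dt u (X z1 t) t)
    - - (lam * E) * (step z2 - step z1)).
  have h1 := sol_along sol t0 tS (has_deriv_moving_point_time q l0 sg z1 t).
  have h2 := sol_along sol t0 tS (has_deriv_moving_point_time q l0 sg z2 t).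
  rewrite /W /=; apply: has_deriv_eqr.
    apply: has_deriv_add; last first.
      apply: has_deriv_opp; apply: has_deriv_mul; last exact: has_deriv_const.
      by derive_rules.
    apply: has_deriv_add; last exact: has_deriv_opp h1.
    apply: has_deriv_add; last exact: h2.
    by derive_rules.
  by rewrite /= /E -/(X z1 t) -/(X z2 t); ring.
rewrite (sol_eq sol (X z1 t) t0 tS) (sol_eq sol (X z2 t) t0 tS) p1 p2.
have l2 : 0 < l ^+ 2 by rewrite exprn_gt0.
apply: (@two_point_touching R N m _ _ _ E l sg lam F) => //.
- exact: reaction_ge0.
- by apply: mu; rewrite (ltW t0).
- by apply: mu; rewrite (ltW t0).
- by rewrite mulr_gt0// expR_gt0.
- move: Wt; rewrite /W /= -/E => Wt.
  have := step_incr_le z10 (ltW z12) z21 => /andP[st0 _].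
  have := mulr_ge0 E0 st0; move: Wt; clear; set a := E * _.
  move: a (u _ _) (u _ _) (d * _) => a b c e; lra.
- by rewrite lpos (le_trans llq)// (le_trans qh)// invf_le1// ler1n.
- apply: le_trans hlam _; apply: ler_wpM2l; first by rewrite mulr_ge0.
  by rewrite lerXn2r// nnegrE ltW.
- exact: ltW.
- rewrite (ltW (f_gt0 _)) /=; apply: le_trans fF; apply: f_le => //; first exact: X0.
  by apply: X1; apply: le_trans (ltW z12) z21.
- by apply: f_le; [exact: X0|exact/X_le/ltW|exact: X1].
- rewrite ler_pdivlMr// expr2 mulrA.
  by move: q1; rewrite addrC subr_ge0.
- rewrite ler_pdivrMr// expr2 [leRHS]mulrA.
  by move: q2; rewrite subr_ge0.
Qed.

Lemma two_point (q l0 sg ep lam F tau : R) :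
  0 <= tau -> (tau%:E < S)%E ->
  0 < l0 -> 0 <= sg -> 0 <= ep <= l0 -> 0 <= lam ->
  l0 + sg * tau <= q -> q <= 2^-1 -> f 2^-1 <= F ->
  (20 + 3 * sg + 2 * F) ^+ 2 <= 4 * lam * l0 ^+ 2 ->
  (forall t, 0 < t <= tau -> 0 <= dx u (q - (l0 + sg * t)) t /\ 0 <= dx u q t) ->
  (forall z1 z2, 0 <= z1 -> z1 <= z2 -> z2 <= 1 ->
     ep * (step z2 - step z1) <= g (q - (1 - z2) * l0) - g (q - (1 - z1) * l0)) ->
  forall z1 z2 t, 0 <= z1 -> z1 <= z2 -> z2 <= 1 -> 0 <= t <= tau ->
    ep * expR (- lam * t) * (step z2 - step z1) <=
    u (moving_point q l0 sg z2 t) t - u (moving_point q l0 sg z1 t) t.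
Proof.
move=> tau0 tauS l00 sg0 epl lam0 lq qh fF hlam bdry init z1 z2 t z10 z12 z21 tt.
have [K HK] := two_point_strict tau0 tauS l00 sg0 epl lam0 lq qh fF hlam bdry init.
apply/ler_addgt0Pr => e e0; have E0 := expR_gt0 (K * t).
have := HK (e / expR (K * t)) z1 z2 t; rewrite divr_gt0// divfK ?gt_eqF//.
move=> /(_ isT z10 z12 z21 tt).
move: (u _ _) (u _ _) (ep * _ * _) => a b c; lra.
Qed.

End TwoPoint.

(** * Behaviour at the quenching time *)

Section TorusData.
Context {R : realType}.
Implicit Types (f : R -> R) (x y : R).

Lemma torus_has_deriv k f x : torus_pos_Ck k.+1 f -> has_deriv x f (derive1 f x).
Proof.
by case=> _ _ H _; have /derivableP := H 0%N x (ltn0Sn k); rewrite derive1E.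
Qed.

Lemma torus_le k f : torus_pos_Ck k.+1 f ->
  (forall x, 0 <= x <= 2^-1 -> 0 <= derive1 f x) ->
  forall x y, 0 <= x -> x <= y -> y <= 2^-1 -> f x <= f y.
Proof.
move=> hf H x y x0; rewrite le_eqVlt => /orP[/eqP->//|xy] yh.
have [c /andP[xc cy] E] := mvt xy (fun z _ => torus_has_deriv z hf).
rewrite -subr_ge0 E mulr_ge0 ?subr_ge0 ?(ltW xy)//; apply: H.
by rewrite (le_trans x0 (ltW xc)) (le_trans (ltW cy) yh).
Qed.

Lemma has_deriv_unique f x a b : has_deriv x f a -> has_deriv x f b -> a = b.
Proof. by move=> [_ <-] [_ <-]. Qed.

Lemma le_half_all f : periodic f 1 -> (forall x, f (- x) = f x) ->
  (forall x y, 0 <= x -> x <= y -> y <= 2^-1 -> f x <= f y) ->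
  forall x, f 0 <= f x <= f 2^-1.
Proof.
move=> fp fe fm x; have h0 : (0 : R) <= 2^-1 by rewrite invr_ge0.
have [y [k [/andP[y0 yh] [->|->]]]] := fold_half x;
  by rewrite (periodic_int fp) ?fe !fm.
Qed.

End TorusData.

Lemma sqrt_sqrD1_le {R : realType} (p : R) : Num.sqrt (p ^+ 2 + 1) <= 1 + `|p|.
Proof.
have p0 : 0 <= `|p| by [].
rewrite -(@ler_pXn2r _ 2) ?nnegrE ?sqrtr_ge0 ?addr_ge0//.
rewrite sqr_sqrtr ?addr_ge0 ?sqr_ge0// -(real_normK (num_real p)) !expr2.
by move: p0; move: `|p| => a; lra.
Qed.

(** Bounds u_t where a parabola with second derivative [2 * A] and slope at most [P] touches u from
    above. *)
Lemma barrier_speed {R : realType} (A p P U f F r : R) :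
  0 <= A -> U <= 2 * A -> `|p| <= P -> 0 <= r -> 0 <= f <= F ->
  U / (p ^+ 2 + 1) - r + f * Num.sqrt (p ^+ 2 + 1) <= 2 * A + F * (1 + P).
Proof.
move=> A0 UA pP r0 /andP[f0 fF].
have q1 : 1 <= p ^+ 2 + 1 by rewrite lerDr sqr_ge0.
have q0 : 0 < p ^+ 2 + 1 by exact: lt_le_trans q1.
have h1 : U / (p ^+ 2 + 1) <= 2 * A.
  rewrite ler_pdivrMr//; apply: le_trans UA _.
  by apply: ler_peMr q1; rewrite mulr_ge0.
have h2 : f * Num.sqrt (p ^+ 2 + 1) <= F * (1 + P).
  apply: ler_pM; rewrite ?sqrtr_ge0//.
  by apply: le_trans (sqrt_sqrD1_le p) _; rewrite lerD2l.
lra.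
Qed.

Lemma C1_increment {R : realType} (h h' : R -> R) :
  (forall x, has_deriv x h (h' x)) -> continuous h' ->
  exists2 M, 0 <= M & forall x d, 0 <= x -> 0 <= d -> x + d <= 2^-1 ->
    h (x + d) - h x <= M * d.
Proof.
move=> dh ch; have h0 : (0 : R) <= 2^-1 by rewrite invr_ge0.
have [|c _ cmax] := EVT_max h0 (f := h'); first exact: continuous_subspaceT.
exists (Num.max 0 (h' c)); first by rewrite le_max lexx.
move=> x d x0 d_ge0 xd.
have [->|dN] := eqVneq d 0; first by rewrite addr0 subrr mulr0.
have dpos : 0 < d by rewrite lt_neqAle eq_sym dN.
have xxd : x < x + d by rewrite ltrDl.
have [z /andP[xz zd] ->] := mvt xxd (fun z _ => dh z).
rewrite addrC addKr ler_pM2r// le_max cmax ?orbT// in_itv /=.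
by rewrite (le_trans x0 (ltW xz)) (le_trans (ltW zd)).
Qed.

(** Primes mark values at the shifted point, and [p] is the common slope. The forcing terms differ
    by at most [F1 * h * (1 + p)]; the transport term cancels [F1 * h * p], and the rest is less
    than [P]. *)
Lemma shift_touching {R : realType} (k F1 h P p U U' r r' f f' : R) :
  0 <= p -> 0 <= - U' + U -> F1 * h < P -> f' - f <= F1 * h -> 0 <= F1 * h ->
  r - r' <= k * P ->
  0 < (k + 1) * P - (p * (- F1 * h)
      + (U' / (p ^+ 2 + 1) - r' + f' * Num.sqrt (p ^+ 2 + 1))
      - (U / (p ^+ 2 + 1) - r + f * Num.sqrt (p ^+ 2 + 1))).
Proof.
move=> p0 UU FP ff Fh rr.
have q0 : 0 < p ^+ 2 + 1 by rewrite ltr_wpDl// sqr_ge0.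
have h1 : U' / (p ^+ 2 + 1) <= U / (p ^+ 2 + 1).
  by rewrite ler_pM2r ?invr_gt0// -subr_ge0 addrC.
have h2 : (f' - f) * Num.sqrt (p ^+ 2 + 1) <= F1 * h * (1 + p).
  apply: (@le_trans _ _ (F1 * h * Num.sqrt (p ^+ 2 + 1))).
    by apply: ler_wpM2r => //; exact: sqrtr_ge0.
  by apply: ler_wpM2l => //; rewrite -[in leRHS](ger0_norm p0) sqrt_sqrD1_le.
move: h1 h2 FP rr; rewrite mulrBl.
move: (U' / _) (U / _) (f' * _) (f * _) => a b c d; lra.
Qed.

Section Flow.
Context {R : realType}.
Variables (n : nat) (f g : R -> R) (S : \bar R) (u : R -> R -> R).
Hypothesis sol : positive_classical_solution n f g S u.
Hypothesis n1 : (1 <= n)%N.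
Hypothesis hf : torus_pos_Ck 1 f.
Hypothesis hg : torus_pos_Ck 2 g.
Hypothesis f_sym : forall x, 0 <= x <= 1 -> f x = f (1 - x).
Hypothesis g_sym : forall x, 0 <= x <= 1 -> g x = g (1 - x).
Hypothesis f_mono : forall x, 0 <= x <= 2^-1 -> 0 <= derive1 f x.
Hypothesis g_mono : forall x, 0 <= x <= 2^-1 -> 0 <= derive1 g x.
Local Notation N := (n%:R - 1 : R).
Implicit Types (x y z r s t tau e m K d : R).

(** * Symmetry and monotonicity of the solution in space *)

Lemma f_gt0 x : 0 < f x. Proof. by case: hf. Qed.
Lemma g_gt0 x : 0 < g x. Proof. by case: hg. Qed.
Lemma f_even x : f (- x) = f x.
Proof. by apply: periodic_even => //; case: hf. Qed.
Lemma g_even x : g (- x) = g x.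
Proof. by apply: periodic_even => //; case: hg. Qed.
Lemma f_le x y : 0 <= x -> x <= y -> y <= 2^-1 -> f x <= f y.
Proof. exact: (torus_le hf f_mono). Qed.
Lemma g_le x y : 0 <= x -> x <= y -> y <= 2^-1 -> g x <= g y.
Proof. exact: (torus_le hg g_mono). Qed.
Lemma f_le_half x : f x <= f 2^-1.
Proof. by have /andP[] := le_half_all (let: And4 p _ _ _ := hf in p) f_even f_le x. Qed.
Lemma g_le_half x : g x <= g 2^-1.
Proof. by have /andP[] := le_half_all (let: And4 p _ _ _ := hg in p) g_even g_le x. Qed.

Lemma u_even x t : 0 <= t -> (t%:E < S)%E -> u (- x) t = u x t.
Proof. exact: (sol_even sol n1 f_even g_even). Qed.

Lemma dx_odd x t : 0 < t -> (t%:E < S)%E -> dx u (- x) t = - dx u x t.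
Proof.
move=> t0 tS; apply: (has_deriv_unique (sol_dx sol (- x) t0 tS)).
have H : has_deriv (- - x) (u ^~ t) (dx u x t) by rewrite opprK; exact: (sol_dx sol x t0 tS).
have := has_deriv_refl H; rewrite (_ : (fun y => u (- y) t) = u ^~ t) //.
by apply/funext => y; rewrite u_even// ltW.
Qed.

Lemma dx_periodic x t : 0 < t -> (t%:E < S)%E -> dx u (x + 1) t = dx u x t.
Proof.
move=> t0 tS; apply/esym; apply: (has_deriv_unique (sol_dx sol x t0 tS)).
have H : has_deriv x (fun y => y + 1) (1 + 0).
  by apply: has_deriv_add; [exact: has_deriv_var|exact: has_deriv_const].
have := @has_deriv_comp _ (u ^~ t) (fun y => y + 1) x _ _ (sol_dx sol (x + 1) t0 tS) H.
rewrite addr0 mulr1 (_ : (fun y => u (y + 1) t) = u ^~ t) //.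
by apply/funext => y; rewrite (sol_periodic sol (ltW t0) tS).
Qed.

Lemma dx_0 t : 0 < t -> (t%:E < S)%E -> dx u 0 t = 0.
Proof.
move=> t0 tS; have := dx_odd 0 t0 tS; rewrite oppr0 => E.
by apply/eqP; rewrite -[_ == _](mulrn_eq0 _ 2) mulr2n {1}E addNr.
Qed.

Lemma dx_half t : 0 < t -> (t%:E < S)%E -> dx u 2^-1 t = 0.
Proof.
move=> t0 tS; have := dx_odd 2^-1 t0 tS; rewrite -(dx_periodic _ t0 tS).
rewrite (_ : - 2^-1 + 1 = 2^-1 :> R); last lra.
by move=> E; apply/eqP; rewrite -[_ == _](mulrn_eq0 _ 2) mulr2n {1}E addNr.
Qed.

(** The two-point comparison with amplitude 0 on the fixed interval [[0, 1/2]], at whose ends u_x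
    vanishes by symmetry. *)
Lemma u_le x y t : 0 <= t -> (t%:E < S)%E ->
  0 <= x -> x <= y -> y <= 2^-1 -> u x t <= u y t.
Proof.
move=> t0 tS x0 xy yh.
(* This gives equality in the condition on [lam] for [l0 = 1/2]. *)
pose F := f 2^-1; pose lam := (20 + 3 * 0 + 2 * F) ^+ 2.
have h0 : (0 : R) < 2^-1 by rewrite invr_gt0.
have mpE z : moving_point 2^-1 2^-1 0 (2 * z) t = z.
  by rewrite /moving_point; field.
suff : 0 * expR (- lam * t) * (step (2 * y) - step (2 * x)) <=
    u (moving_point 2^-1 2^-1 0 (2 * y) t) t - u (moving_point 2^-1 2^-1 0 (2 * x) t) t.
  by rewrite !mpE !mul0r subr_ge0.
have x2 : 0 <= 2 * x by rewrite mulr_ge0.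
have xy2 : 2 * x <= 2 * y by rewrite ler_pM2l.
have y2 : 2 * y <= 1 by rewrite -ler_pdivlMl// mulr1.
apply: (two_point sol n1 f_gt0 f_le (q := 2^-1) (F := F) (tau := t)) => //.
- by rewrite lexx ltW.
- exact: sqr_ge0.
- by rewrite mul0r addr0.
- by rewrite le_eqVlt; apply/orP; left; apply/eqP; rewrite /lam; field.
- move=> r /andP[r0 rt]; have rS := lt_horizon rt tS.
  by rewrite mul0r addr0 subrr dx_0// dx_half.
- move=> z1 z2 z10 z12 z21; rewrite mul0r subr_ge0; apply: g_le.
  + by rewrite subr_ge0 ler_piMl ?(ltW h0)//; lra.
  + by rewrite lerD2l lerN2 ler_pM2r//; lra.
  + by rewrite lerBlDr lerDl mulr_ge0 ?(ltW h0)//; lra.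
- by rewrite t0 lexx.
Qed.

Lemma u_bounds x t : 0 <= t -> (t%:E < S)%E -> u 0 t <= u x t <= u 2^-1 t.
Proof.
move=> t0 tS; apply: (le_half_all (sol_periodic sol t0 tS)) => [y|y z].
  by rewrite u_even.
exact: u_le.
Qed.

Lemma dx_ge0 x t : 0 < t -> (t%:E < S)%E -> 0 <= x -> x <= 2^-1 -> 0 <= dx u x t.
Proof.
move=> t0 tS x0; rewrite le_eqVlt => /orP[/eqP->|xh]; first by rewrite dx_half.
have r0 : 0 < 2^-1 - x by rewrite subr_gt0.
apply: (has_deriv_ge0_right r0 (sol_dx sol x t0 tS)) => y /andP[xy yh].
by apply: u_le => //; [exact: ltW|exact: ltW|move: yh; rewrite addrC subrK => /ltW].
Qed.

(** At the minimum point 0, u_x = 0 and u_xx >= 0, and the forcing term is positive. *)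
Lemma dt_0_ge t : 0 < t -> (t%:E < S)%E -> - (N / u 0 t) <= dt u 0 t.
Proof.
move=> t0 tS; rewrite (sol_eq sol 0 t0 tS) dx_0// expr0n /= add0r sqrtr1 invr1 !mulr1.
have : 0 <= dxx u 0 t.
  apply: (has_deriv2_ge0_right ltr01 (fun y _ => sol_dx sol y t0 tS) (sol_dxx sol 0 t0 tS)).
    exact: dx_0.
  by move=> y _; have /andP[] := u_bounds y (ltW t0) tS.
have := f_gt0 0; move: (f 0) (dxx u 0 t) (N / _) => a b c; lra.
Qed.

Lemma dt_half_le t : 0 < t -> (t%:E < S)%E -> dt u 2^-1 t <= f 2^-1 - N / u 2^-1 t.
Proof.
move=> t0 tS; rewrite (sol_eq sol _ t0 tS) dx_half// expr0n /= add0r sqrtr1 invr1 !mulr1.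
have : 0 <= - dxx u 2^-1 t.
  apply: (has_deriv2_ge0_right ltr01 (fun y _ => has_deriv_opp (sol_dx sol y t0 tS))
    (has_deriv_opp (sol_dxx sol 2^-1 t0 tS))).
    by rewrite dx_half// oppr0.
  by move=> y _; rewrite lerN2; have /andP[] := u_bounds y (ltW t0) tS.
move: (f _) (dxx u _ t) (N / _) => a b c; lra.
Qed.

(** * Decay of the maximum and finiteness of the horizon *)

Hypothesis g_lt : g 0 < g 2^-1.
Hypothesis hmax : f 2^-1 * g 2^-1 < N.

(** While the maximum stays below [B], its time derivative is at most [f 2^-1 - N / B], which is
    [- 2 * c] for the [c] chosen; the barrier [B - c * t] is thus never reached. The maximum
    principle is applied over a one-point space. *)
Lemma max_decay : exists B c, [/\ 0 < B, 0 < c, f 2^-1 + c <= N / B &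
  forall t, 0 <= t -> (t%:E < S)%E -> u 2^-1 t < B - c * t].
Proof.
set F := f 2^-1; set G := g 2^-1.
have hm : F * G < N by exact: hmax.
have F0 : 0 < F by exact: f_gt0.
have G0 : 0 < G by exact: g_gt0.
(* Then [F * (G + e)] is the midpoint of [F * G] and [N]. *)
pose e := (N - F * G) / (2 * F).
have e0 : 0 < e by rewrite divr_gt0 ?mulr_gt0// subr_gt0.
pose B := G + e; have B0 : 0 < B by rewrite addr_gt0.
have FB : F < N / B.
  rewrite ltr_pdivlMr// /B mulrDr (_ : F * e = (N - F * G) / 2); last first.
    by rewrite /e; field; rewrite gt_eqF.
  by move: hm; move: (F * G) => a; lra.
pose c := (N / B - F) / 2; have c0 : 0 < c by rewrite divr_gt0// subr_gt0.
exists B, c; split => //; first by rewrite /c -/F; move: FB; move: (N / B) => a; lra.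
move=> t t0 tS; rewrite -subr_gt0.
apply: (@max_principle R R [set 0] (fun _ s => B - c * s - u 2^-1 s) 0 t _ _ _ _ 0) => //.
- exact: compact_set1.
- apply: within_sub.
    apply: (within_snd (h := fun s => B - c * s)) => s.
    by apply: cvgB; [exact: cvg_cst|apply: cvgM; [exact: cvg_cst|exact: cvg_id]].
  apply: (sol_within sol (xi := fun=> 2^-1)) => [p|p]; first exact: cvg_cst.
  by rewrite /= in_itv /= => -[_ /andP[? ?]]; split => //; exact: lt_horizon tS.
- by move=> _ _; rewrite mulr0 subr0 (sol_init sol) /B -/G addrC addKr.
- move=> _ s _ /andP[s0 st] E _; have sS := lt_horizon st tS.
  exists (0 - (c * 1 + s * 0) - dt u 2^-1 s).
    apply: has_deriv_add; last by apply: has_deriv_opp; exact: (sol_dt sol).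
    by derive_rules.
  have us : u 2^-1 s <= B.
    have : 0 <= c * s by rewrite mulr_ge0// ltW.
    by move: E; move: (u _ _) (c * s) => a b; lra.
  have : N / B <= N / u 2^-1 s.
    apply: ler_wpM2l; first exact: reaction_ge0.
    by rewrite lef_pV2 ?posrE// (sol_gt0 sol)// ltW.
  have := dt_half_le s0 sS; rewrite /c -/F mulr0 addr0 mulr1 sub0r.
  move: FB; move: (N / B) (N / _) (dt _ _ _) => a b d; lra.
- by rewrite t0 lexx.
Qed.

Lemma horizon_finite : (0 < S)%E -> exists2 T : R, 0 < T & S = T%:E.
Proof.
move=> S0; have [B [c [B0 c0 _ H]]] := max_decay.
have t0 : 0 <= B / c by rewrite divr_ge0 ?(ltW B0) ?(ltW c0).
case ES : S S0 => [T| |] // S0; first by exists T; rewrite -?lte_fin.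
have tS : ((B / c)%:E < S)%E by rewrite ES ltry.
have := lt_trans (sol_gt0 sol 2^-1 t0 tS) (H _ t0 tS).
by rewrite mulrC divfK ?gt_eqF// subrr ltxx.
Qed.

(** * The minimum near the horizon *)

Variable T : R.
Hypothesis T0 : 0 < T.
Hypothesis ST : S = T%:E.

Lemma ltS t : t < T -> (t%:E < S)%E. Proof. by rewrite ST lte_fin. Qed.

(* Integrates (u(0,t)^2)' >= - 2 (n - 1). *)
Lemma sqr_min_decay s t : 0 < s -> s <= t -> t < T ->
  u 0 s ^+ 2 - 2 * N * (t - s) <= u 0 t ^+ 2.
Proof.
move=> s0 + tT; rewrite le_eqVlt => /orP[/eqP->|st]; first by rewrite subrr mulr0 subr0.
have dv r : s <= r <= t -> has_deriv r (fun r => u 0 r * u 0 r + 2 * N * r)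
    (u 0 r * dt u 0 r + u 0 r * dt u 0 r + 2 * N).
  move=> /andP[sr rt]; have h := sol_dt sol 0 (lt_le_trans s0 sr) (ltS (le_lt_trans rt tT)).
  by apply: has_deriv_eqr; [derive_rules|rewrite /=; ring].
have [c /andP[sc ct] E] := mvt st dv.
have c0 : 0 < c by exact: lt_trans sc.
have cS := ltS (lt_trans ct tT).
have uc0 := sol_gt0 sol 0 (ltW c0) cS.
have : - N <= u 0 c * dt u 0 c.
  have := ler_wpM2l (ltW uc0) (dt_0_ge c0 cS).
  by rewrite mulrN mulrCA divff ?gt_eqF// mulr1.
move=> H; have : 0 <= (u 0 c * dt u 0 c + u 0 c * dt u 0 c + 2 * N) * (t - s).
  apply: mulr_ge0; last by rewrite subr_ge0 ltW.
  by move: H; move: (u 0 c * _) => a; lra.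
rewrite -E !expr2; move: (u 0 t * _) (u 0 s * _) => a b; lra.
Qed.

Hypothesis hinf : inf [set u p.1 p.2 | p in slab S] = 0.

(** If [u 0 t0 >= e] at some time [t0] close to [T], the decay bound for the square keeps [u 0]
    above [e / 2] until [T]. With the lower bound [m] up to time [t0], u is then bounded away from 0
    on the whole slab, against [hinf]. *)
Lemma min_quenches e : 0 < e -> exists2 s, 0 < s < T &
  forall t, s <= t -> t < T -> u 0 t < e.
Proof.
move=> e0; have N0 := @reaction_ge0 R n n1.
(* During a time [k] the square loses at most [2 * (N + 1) * k = e ^+ 2 / 2]. *)
pose k := e ^+ 2 / (4 * (N + 1)).
have N10 : 0 < N + 1 by rewrite subrK ltr0n.
have k0 : 0 < k by apply: divr_gt0; [exact: exprn_gt0|exact: mulr_gt0].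
pose s := Num.max (T / 2) (T - k).
have s0 : 0 < s by rewrite lt_max divr_gt0.
have sT : s < T.
  by rewrite gt_max; apply/andP; split; [move: T0 => ?; lra|rewrite ltrBlDr ltrDl].
exists s; first by rewrite s0.
apply: contrapT => /existsNP[t0 /not_implyP[st0 /not_implyP[t0T /negP]]].
rewrite -leNgt => et0.
have t00 : 0 < t0 by exact: lt_le_trans st0.
have [m m0 mu] := sol_lbound sol (ltW t00) (ltS t0T).
have late t : t0 <= t -> t < T -> e / 2 <= u 0 t.
  move=> t0t tT; have tt0 : 0 < t by exact: lt_le_trans t0t.
  have ut0 := sol_gt0 sol 0 (ltW tt0) (ltS tT).
  have H := sqr_min_decay t00 t0t tT.
  have e2 : e ^+ 2 <= u 0 t0 ^+ 2 by rewrite lerXn2r ?nnegrE ?(ltW e0)// (le_trans (ltW e0)).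
  have tk : t - t0 <= k.
    have : T - k <= s by rewrite le_max lexx orbT.
    by move: st0 tT; lra.
  have : 2 * N * (t - t0) <= e ^+ 2 / 2.
    apply: (@le_trans _ _ (2 * (N + 1) * k)); last first.
      rewrite /k le_eqVlt; apply/orP; left; apply/eqP.
      by move: (lt0r_neq0 N10); move: (N + 1) => a a0; field.
    apply: ler_pM tk.
    - by rewrite mulr_ge0.
    - by rewrite subr_ge0.
    - by rewrite ler_pM2l// lerDl.
  move=> H2; rewrite -(@ler_pXn2r _ 2) ?nnegrE ?(ltW ut0) ?divr_ge0 ?(ltW e0)//.
  rewrite exprMn [2^-1 ^+ 2]expr2; move: H2; move: (sqr_ge0 e) e2 H.
  move: (e ^+ 2) (u 0 t0 ^+ 2) (u 0 t ^+ 2) (2 * N * _).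
  move=> a b c d; lra.
have : Num.min m (e / 2) <= inf [set u p.1 p.2 | p in slab S].
  apply: lb_le_inf; first by exists (u 0 0), (0, 0) => //; split => //=; apply: ltS.
  move=> _ [[x t] [/= t_ge0 tS] <-].
  have tT : t < T by move: tS; rewrite ST lte_fin.
  have [tt0|/ltW tt0] := leP t t0.
    by rewrite ge_min; apply/orP; left; apply: mu; rewrite t_ge0.
  rewrite ge_min; apply/orP; right; apply: le_trans (late t tt0 tT) _.
  by have /andP[] := u_bounds x t_ge0 tS.
by rewrite hinf leNgt lt_min m0 divr_gt0.
Qed.

(** * Quadratic upper barriers *)

Lemma u_bounded : exists2 B, 0 < B & forall x t, 0 <= t -> t < T -> u x t < B.
Proof.
have [B [c [B0 c0 _ H]]] := max_decay; exists B => // x t t0 tT.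
have /andP[_ uh] := u_bounds x t0 (ltS tT).
apply: le_lt_trans uh _; apply: lt_le_trans (H t t0 (ltS tT)) _.
by rewrite lerBlDr lerDl mulr_ge0// ltW.
Qed.

(** A parabola centred at [x] and rising at speed [C] starts above u at time [s], since evenness and
    monotonicity give [u y s <= u (x + r) s] on [[x - r, x + r]]. The constant depends on [r]
    alone. *)
Lemma upper_barrier r : 0 < r -> exists2 C, 0 <= C &
  forall x s t, 0 <= x -> x + r <= 2^-1 -> 0 <= s -> s <= t -> t < T ->
    u x t <= u (x + r) s + C * (t - s).
Proof.
move=> r0; have [B B0 uB] := u_bounded.
pose A := B / r ^+ 2; have r20 : 0 < r ^+ 2 by rewrite exprn_gt0.
have A0 : 0 < A by rewrite divr_gt0.
have AB : A * r ^+ 2 = B by rewrite /A divfK// gt_eqF.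
set F := f 2^-1; have F0 : 0 < F by exact: f_gt0.
pose C := 2 * A + F * (1 + 2 * A * r) + 1.
have C0 : 0 <= C.
  have A2 : 0 <= 2 * A by rewrite mulr_ge0// ltW.
  apply: addr_ge0 => //; apply: addr_ge0 => //; apply: mulr_ge0; first exact: ltW.
  by apply: addr_ge0 => //; apply: mulr_ge0 => //; exact: ltW.
exists C => // x s t x0 xr s0 st tT.
apply/ler_addgt0Pr => d d0; apply: ltW; rewrite -subr_gt0.
pose W y q := u (x + r) s + d + A * ((y - x) * (y - x)) + C * (q - s) - u y q.
have -> : u (x + r) s + C * (t - s) + d - u x t = W x t by rewrite /W; ring.
have IT y : `[x - r, x + r]%classic y -> x - r <= y <= x + r by rewrite /= in_itv.
apply: (@max_principle R R `[x - r, x + r] W s t).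
- exact: segment_compact.
- apply: within_sub; first apply: within_add.
  + apply: (within_fst (h := fun y => u (x + r) s + d + A * ((y - x) * (y - x)))) => y.
    apply: (@has_deriv_continuous _ (fun y => u (x + r) s + d + A * ((y - x) * (y - x)))).
    by derive_rules.
  + apply: (within_snd (h := fun q => C * (q - s))) => y.
    apply: (@has_deriv_continuous _ (fun q => C * (q - s))).
    by derive_rules.
  + apply: (sol_within sol (xi := fst)) => [p|p]; first exact: cvg_fst.
    rewrite /= !in_itv /= => -[_ /andP[sp pt]]; split; first exact: le_trans sp.
    exact/ltS/(le_lt_trans pt).
- move=> y /IT /andP[y1 y2]; rewrite /W subrr mulr0 addr0.
  have : u y s <= u (x + r) s.
    have sS := ltS (le_lt_trans st tT).
    have [y0|/ltW y0] := leP 0 y; first exact: u_le.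
    rewrite -u_even//; apply: u_le => //; first by rewrite oppr_ge0.
    by move: x0 r0 y1; lra.
  have : 0 <= A * ((y - x) * (y - x)) by rewrite mulr_ge0 ?(ltW A0)// -expr2 sqr_ge0.
  by move: d0; move: (u _ _) (u _ _) (A * _) => a b c; lra.
- move=> y q /IT /andP[y1 y2] /andP[sq qt] Wq Wmin.
  have q0 : 0 < q by exact: le_lt_trans sq.
  have qT : q < T by exact: le_lt_trans tT.
  have qS := ltS qT.
  have Cq : 0 <= C * (q - s) by rewrite mulr_ge0// subr_ge0 ltW.
  (* At distance [r] from [x] the parabola exceeds the global bound [B], so touching occurs in the
     interior. *)
  have side : (y - x) * (y - x) < r ^+ 2.
    rewrite ltNge; apply/negP => H.
    have : B <= A * ((y - x) * (y - x)) by rewrite -AB ler_pM2l.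
    have := uB y q (ltW q0) qT; have := sol_gt0 sol (x + r) s0 (ltS (le_lt_trans st tT)).
    move: Wq Cq d0; rewrite /W; move: (u _ _) (u _ _) (A * _) (C * _) => a b c e; lra.
  have yr : `|y - x| < r by rewrite -ltr_sqr ?nnegrE ?(ltW r0)// real_normK ?num_real// expr2.
  move: (yr); rewrite ltr_norml => /andP[yr1 yr2].
  pose k := Num.min (y - (x - r)) (x + r - y).
  have k0 : 0 < k by rewrite lt_min; apply/andP; split; [move: yr1|move: yr2]; lra.
  have k1 : k <= y - (x - r) by rewrite ge_min lexx.
  have k2 : k <= x + r - y by rewrite ge_min lexx orbT.
  have Wle z : y - k < z < y + k -> W y q <= W z q.
    move=> /andP[z1 z2]; rewrite Wq; apply: Wmin; rewrite /= in_itv /=.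
    by apply/andP; split; [move: z1 k1|move: z2 k2]; lra.
  have dW z : has_deriv z (W ^~ q) (2 * A * (z - x) - dx u z q).
    have h := sol_dx sol z q0 qS.
    by rewrite /W; apply: has_deriv_eqr; [derive_rules|rewrite /=; ring].
  have ddW : has_deriv y (fun z => 2 * A * (z - x) - dx u z q) (2 * A - dxx u y q).
    have h := sol_dxx sol y q0 qS.
    by apply: has_deriv_eqr; [derive_rules|rewrite /=; ring].
  have p0 : 2 * A * (y - x) - dx u y q = 0.
    apply/eqP; rewrite eq_le; apply/andP; split.
      apply: (has_deriv_le0_left k0 (dW y)) => z /andP[z1 z2]; apply: Wle.
      by rewrite z1 (lt_trans z2)// ltrDl.
    apply: (has_deriv_ge0_right k0 (dW y)) => z /andP[z1 z2]; apply: Wle.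
    by rewrite z2 andbT (lt_trans _ z1)// ltrBlDr ltrDl.
  have pp : 0 <= 2 * A - dxx u y q.
    apply: (has_deriv2_ge0_right k0 (fun z _ => dW z) ddW p0) => z /andP[z1 z2].
    by apply: Wle; rewrite z2 andbT (lt_trans _ z1)// ltrBlDr ltrDl.
  exists (C - dt u y q).
    have h := sol_dt sol y q0 qS.
    by rewrite /W; apply: has_deriv_eqr; [derive_rules|rewrite /=; ring].
  rewrite (sol_eq sol y q0 qS) subr_gt0.
  have px : `|dx u y q| <= 2 * A * r.
    move/eqP: p0; rewrite subr_eq0 => /eqP <-.
    have A2 : 0 < 2 * A by rewrite mulr_gt0.
    by rewrite normrM (gtr0_norm A2); apply: ler_wpM2l; exact: ltW.
  apply: (@le_lt_trans _ _ (2 * A + F * (1 + 2 * A * r))); last by rewrite ltrDl.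
  apply: barrier_speed => //; first exact: ltW.
  - by rewrite -subr_ge0.
  - by rewrite divr_ge0 ?reaction_ge0// ltW// (sol_gt0 sol)// ltW.
  - by rewrite (ltW (f_gt0 _)) f_le_half.
- by rewrite /= in_itv /= lerBlDr !lerDl (ltW r0).
- by rewrite st lexx.
Qed.

(** * Comparison with a shifted copy *)

Lemma f_lipschitz : exists2 F1, 0 <= F1 & forall x h,
  0 <= x -> 0 <= h -> x + h <= 2^-1 -> f (x + h) - f x <= F1 * h.
Proof.
by apply: (C1_increment (fun x => torus_has_deriv x hf)); case: hf.
Qed.

Lemma u_lipschitz t : 0 < t -> t < T -> exists2 M, 0 <= M & forall x h,
  0 <= x -> 0 <= h -> x + h <= 2^-1 -> u (x + h) t - u x t <= M * h.
Proof.
move=> t0 tT; apply: (C1_increment (fun x => sol_dx sol x t0 (ltS tT))) => x.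
exact: has_deriv_continuous (sol_dxx sol x t0 (ltS tT)).
Qed.

(* The shift H decreases fast enough for the transport term H' u_x, where
   u_x >= 0, to absorb the difference of the forcing terms. *)
Lemma shift_bound (al be s tau F1 kap : R) (H P : R -> R) :
  0 < al -> 0 <= s -> tau < T -> 0 < kap -> 0 <= F1 ->
  (forall x h, 0 <= x -> 0 <= h -> x + h <= 2^-1 -> f (x + h) - f x <= F1 * h) ->
  (forall x t, al <= x -> x <= 2^-1 -> s <= t <= tau -> kap <= u x t) ->
  (forall t, has_deriv t H (- F1 * H t)) ->
  (forall t, has_deriv t P ((N / kap ^+ 2 + 1) * P t)) ->
  (forall t, s <= t <= tau -> 0 <= H t /\ be + H t <= 2^-1) ->
  (forall t, s <= t <= tau -> F1 * H t < P t) ->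
  (forall t, 0 < P t) ->
  (forall t, s <= t <= tau -> u (al + H t) t - u al t < P t) ->
  (forall t, s <= t <= tau -> u (be + H t) t - u be t < P t) ->
  (forall x, al <= x <= be -> u (x + H s) s - u x s < P s) ->
  forall x t, al <= x <= be -> s <= t <= tau -> u (x + H t) t - u x t < P t.
Proof.
move=> al0 s0 tauT kap0 F10 fL ukap dH dP H0 F1P P0 lat1 lat2 init x t xI tI.
rewrite -subr_gt0; pose W y q := P q - (u (y + H q) q - u y q).
have IT y : `[al, be]%classic y -> al <= y <= be by rewrite /= in_itv.
apply: (@max_principle R R `[al, be] W s tau) => //.
- exact: segment_compact.
- have AS (p : R * R) : (`[al, be]%classic `*` `[s, tau]%classic) p ->
      0 <= p.2 /\ (p.2%:E < S)%E.
    rewrite /= !in_itv /= => -[_ /andP[sp pt]]; split; first exact: le_trans sp.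
    exact/ltS/(le_lt_trans pt).
  apply: within_sub.
    by apply: (within_snd (h := P)) => q; exact: has_deriv_continuous (dP q).
  apply: within_sub.
    apply: (sol_within sol (xi := fun p => p.1 + H p.2)) => // p.
    apply: cvgD; first exact: cvg_fst.
    by apply: cvg_comp; [exact: cvg_snd|exact: has_deriv_continuous (dH _)].
  by apply: (sol_within sol (xi := fst)) => // p; exact: cvg_fst.
- by move=> y /IT yI; rewrite subr_gt0; exact: init.
move=> y q /IT /andP[aly ybe] /andP[sq qtau] Wq Wmin.
have qI : s <= q <= tau by rewrite (ltW sq).
have q0 : 0 < q by exact: le_lt_trans sq.
have qS := ltS (le_lt_trans qtau tauT).
have {}aly : al < y.
  rewrite lt_neqAle aly andbT; apply/eqP => E; have := lat1 q qI.
  by rewrite E -subr_gt0 -/(W y q) Wq ltxx.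
have {}ybe : y < be.
  rewrite lt_neqAle ybe andbT; apply/eqP => E; have := lat2 q qI.
  by rewrite -E -subr_gt0 -/(W y q) Wq ltxx.
pose k := Num.min (y - al) (be - y).
have k0 : 0 < k by rewrite lt_min !subr_gt0 aly.
have k1 : k <= y - al by rewrite ge_min lexx.
have k2 : k <= be - y by rewrite ge_min lexx orbT.
have Wle z : y - k < z < y + k -> W y q <= W z q.
  move=> /andP[z1 z2]; rewrite Wq; apply: Wmin; rewrite /= in_itv /=.
  by apply/andP; split; [move: z1 k1|move: z2 k2]; lra.
have dshift z : has_deriv z (fun z => z + H q) (1 + 0).
  by apply: has_deriv_add; [exact: has_deriv_var|exact: has_deriv_const].
have dW z : has_deriv z (W ^~ q) (- dx u (z + H q) q + dx u z q).
  have h1 := @has_deriv_comp _ (u ^~ q) (fun z => z + H q) z _ _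
    (sol_dx sol (z + H q) q0 qS) (dshift z).
  have h2 := sol_dx sol z q0 qS.
  apply: (has_deriv_eqr (has_deriv_add (has_deriv_const (P q) z)
    (has_deriv_opp (has_deriv_add h1 (has_deriv_opp h2))))).
  by rewrite addr0 mulr1 add0r opprB addrC.
have ddW : has_deriv y (fun z => - dx u (z + H q) q + dx u z q) (- dxx u (y + H q) q + dxx u y q).
  have h1 := @has_deriv_comp _ (dx u ^~ q) (fun z => z + H q) y _ _
    (sol_dxx sol (y + H q) q0 qS) (dshift y).
  have h2 := sol_dxx sol y q0 qS.
  apply: (has_deriv_eqr (has_deriv_add (has_deriv_opp h1) h2)).
  by rewrite addr0 mulr1.
have p0 : - dx u (y + H q) q + dx u y q = 0.
  apply/eqP; rewrite eq_le; apply/andP; split.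
    apply: (has_deriv_le0_left k0 (dW y)) => z /andP[z1 z2]; apply: Wle.
    by rewrite z1 (lt_trans z2)// ltrDl.
  apply: (has_deriv_ge0_right k0 (dW y)) => z /andP[z1 z2]; apply: Wle.
  by rewrite z2 andbT (lt_trans _ z1)// ltrBlDr ltrDl.
have pp : 0 <= - dxx u (y + H q) q + dxx u y q.
  apply: (has_deriv2_ge0_right k0 (fun z _ => dW z) ddW p0) => z /andP[z1 z2].
  by apply: Wle; rewrite z2 andbT (lt_trans _ z1)// ltrBlDr ltrDl.
exists ((N / kap ^+ 2 + 1) * P q
   - (dx u (y + H q) q * (- F1 * H q) + dt u (y + H q) q - dt u y q)).
  apply: has_deriv_add; first exact: dP.
  apply: has_deriv_opp; apply: has_deriv_add; last first.
    by apply: has_deriv_opp; exact: (sol_dt sol).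
  apply: (@sol_along _ _ _ _ _ _ sol (fun q => y + H q)) => //.
  by rewrite -[_ * _]add0r; apply: has_deriv_add; [exact: has_deriv_const|exact: dH].
rewrite (sol_eq sol y q0 qS) (sol_eq sol (y + H q) q0 qS).
have -> : dx u (y + H q) q = dx u y q by apply/eqP; rewrite eq_sym -subr_eq0 addrC p0.
have [Hq0 beH] := H0 q qI.
have y0 : 0 <= y by exact: le_trans (ltW al0) (ltW aly).
have yH : y + H q <= 2^-1 by apply: le_trans beH; rewrite lerD2r ltW.
have yh : y <= 2^-1 by apply: le_trans yH; rewrite lerDl.
apply: (@shift_touching R) => //.
- exact: dx_ge0.
- exact: F1P.
- exact: fL.
- exact: mulr_ge0.
- apply: reaction_le => //; first exact: reaction_ge0.
  + by apply: ukap => //; exact: ltW.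
  + by apply: ukap => //; apply: le_trans (ltW aly) _; rewrite lerDl.
  + exact: ltW.
  + by move/eqP: Wq; rewrite subr_eq0 => /eqP ->.
Qed.

(** * Positivity away from the integers *)

(** Since g(0) < g(1/2), the mean value theorem yields a point with g' > 0, and g' is continuous.
    This interval carries the initial bump. *)
Lemma g_steep : exists q l0 k, [/\ 0 < l0, l0 <= q, q <= 2^-1, 0 < k &
  forall x, q - l0 <= x -> x <= q -> k <= derive1 g x].
Proof.
have h0 : (0 : R) < 2^-1 by rewrite invr_gt0.
have [q /andP[q0 qh] E] := mvt h0 (fun z _ => torus_has_deriv z hg).
have gq : 0 < derive1 g q.
  have : 0 < derive1 g q * (2^-1 - 0) by rewrite -E subr_gt0.
  by rewrite subr0 pmulr_lgt0.
have cg : {for q, continuous (derive1 g)}.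
  case: hg => _ _ H _; have /derivableP := H 1%N q isT; exact: has_deriv_continuous.
have g2 : 0 < derive1 g q / 2 by rewrite divr_gt0.
move/cvgrPdist_lt: cg => /(_ _ g2)[r /= r0 Hr].
exists q, (Num.min (r / 2) (q / 2)), (derive1 g q / 2).
have m1 : Num.min (r / 2) (q / 2) <= r / 2 by rewrite ge_min lexx.
have m2 : Num.min (r / 2) (q / 2) <= q / 2 by rewrite ge_min lexx orbT.
split => //.
- by rewrite lt_min !divr_gt0.
- by apply: le_trans m2 _; rewrite ler_pdivrMr// ler_peMr ?ler1n// ltW.
- exact: ltW.
move=> x xl xq.
have : `|derive1 g q - derive1 g x| < derive1 g q / 2.
  apply: (Hr x); rewrite /= ger0_norm ?subr_ge0//.
  by move: xl m1 r0; move: (Num.min _ _) => a; lra.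
by rewrite ltr_norml => /andP[_]; move: (derive1 g x) (derive1 g q) => a b; lra.
Qed.

(** The increment of u from the moving left end to the point of relative coordinate [be] stays above
    a fixed positive number, and for late times that point lies to the left of the position [be]. *)
Lemma interior_positive be : 0 < be -> be <= 2^-1 -> exists2 kap, 0 < kap &
  exists2 s, 0 < s < T & forall x t, be <= x -> x <= 2^-1 -> s <= t -> t < T -> kap <= u x t.
Proof.
(* The speed [sg] makes the left end [q - (l0 + sg * t)] reach 0 exactly at time [T]. *)
move=> be0 beh; have [q [l0 [k [l00 l0q qh k0 gk]]]] := g_steep.
pose sg := (q - l0) / T; have sg0 : 0 <= sg by rewrite divr_ge0 ?subr_ge0// ltW.
have sgT : sg * T = q - l0 by rewrite /sg divfK// gt_eqF.
set F := f 2^-1.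
pose lam := (20 + 3 * sg + 2 * F) ^+ 2 / (4 * l0 ^+ 2).
have lam0 : 0 <= lam by rewrite divr_ge0 ?sqr_ge0// mulr_ge0 ?sqr_ge0.
(* The bound [k * l0] puts the initial bump below the increments of g; the bound [l0] is the
   amplitude condition of [two_point]. *)
pose ep := Num.min (k * l0) l0.
have ep0 : 0 < ep by rewrite lt_min mulr_gt0.
have ep1 : ep <= k * l0 by rewrite ge_min lexx.
have ep2 : ep <= l0 by rewrite ge_min lexx orbT.
have stepbe : 0 < step be.
  have -> : step be = be ^+ 3 * (3^-1 - be / 2 + be ^+ 2 / 5) by rewrite /step; field.
  apply: mulr_gt0; first exact: exprn_gt0.
  by have := sqr_ge0 be; move: beh; move: (be ^+ 2) => a; lra.
exists (ep * expR (- lam * T) * step be).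
  by rewrite !mulr_gt0// expR_gt0.
exists (T * (1 - be)).
  rewrite mulr_gt0//=; last by move: beh; lra.
  by rewrite gtr_pMr// gtrBl.
move=> x t bex xh st tT.
have t0 : 0 < t.
  by apply: lt_le_trans st; rewrite mulr_gt0//; move: beh; lra.
have tS := ltS tT.
have sgt r : 0 <= r -> r <= t -> 0 <= l0 + sg * r <= q.
  move=> r0 rt; have -> /= : 0 <= l0 + sg * r.
    by apply: addr_ge0; [exact: ltW|exact: mulr_ge0].
  by rewrite addrC -lerBrDr -sgT ler_wpM2l// ltW// (le_lt_trans rt).
have := @two_point R n f g S u sol n1 f_gt0 f_le q l0 sg ep lam F t (ltW t0) tS l00 sg0.
have -> : 0 <= ep <= l0 by rewrite (ltW ep0).
have /andP[lt0 ltq] := sgt t (ltW t0) (lexx t).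
move=> /(_ isT lam0 ltq qh (lexx _)) H.
have {}H : ep * expR (- lam * t) * (step be - step 0) <=
    u (moving_point q l0 sg be t) t - u (moving_point q l0 sg 0 t) t.
  apply: H => //.
  - by rewrite /lam le_eqVlt; apply/orP; left; apply/eqP; field; rewrite gt_eqF.
  - move=> r /andP[r0 rt]; have rS := ltS (le_lt_trans rt tT).
    have /andP[? ?] := sgt r (ltW r0) rt.
    have q0 : 0 <= q by exact: le_trans (ltW l00) l0q.
    split; apply: dx_ge0 => //; first by rewrite subr_ge0.
    by rewrite lerBlDr ler_wpDr.
  - move=> z1 z2 z10 z12 z21; have /andP[s0 sz] := step_incr_le z10 z12 z21.
    apply: (@le_trans _ _ (k * (l0 * (z2 - z1)))).
      by rewrite mulrA; apply: ler_pM => //; exact: ltW.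
    have [->|z12N] := eqVneq z1 z2; first by rewrite !subrr !mulr0.
    have lz : q - (1 - z1) * l0 < q - (1 - z2) * l0.
      by rewrite ltrD2l ltrN2 ltr_pM2r// ltrD2l ltrN2 lt_neqAle z12N.
    have [c /andP[c1 c2] ->] := mvt lz (fun z _ => torus_has_deriv z hg).
    rewrite (_ : _ - _ - _ = l0 * (z2 - z1)); last by ring.
    apply: ler_wpM2r; first by rewrite mulr_ge0 ?subr_ge0// ltW.
    apply: gk.
    + apply: le_trans (ltW c1); rewrite lerD2l lerN2 ler_piMl ?(ltW l00)//.
      by rewrite gerBl.
    + by apply: le_trans (ltW c2) _; rewrite gerBl mulr_ge0 ?subr_ge0// ltW.
  - exact: ltW.
  - by apply: le_trans beh _; rewrite invf_le1// ler1n.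
  - by rewrite (ltW t0) lexx.
have mp0 : 0 <= moving_point q l0 sg 0 t by rewrite /moving_point subr0 mul1r subr_ge0.
have be1 : be <= 1 by apply: le_trans beh _; rewrite invf_le1// ler1n.
have mpb0 : 0 <= moving_point q l0 sg be t.
  rewrite /moving_point subr_ge0; apply: le_trans ltq.
  by apply: ler_piMl => //; rewrite gerBl ltW.
(* From time [T * (1 - be)] on, the left end is at most [(q - l0) * be <= be / 2], and the offset
   [be * (l0 + sg * t)] is at most [be / 2]. *)
have mpb : moving_point q l0 sg be t <= be.
  have H1 : (q - l0) * (1 - be) <= sg * t.
    by rewrite -sgT -mulrA; apply: ler_wpM2l.
  have H2 : be * (l0 + sg * t) <= be / 2.
    by rewrite ler_pM2l// (le_trans ltq).
  have H3 : (q - l0) * be <= be / 2.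
    by rewrite mulrC ler_pM2l//; move: qh l00; lra.
  rewrite /moving_point; move: H1 H2 H3; lra.
have step0 : step (0 : R) = 0 by rewrite /step; field.
have ux : u (moving_point q l0 sg be t) t <= u x t.
  apply: u_le => //; [exact: ltW|exact: le_trans bex].
have u0 := sol_gt0 sol (moving_point q l0 sg 0 t) (ltW t0) tS.
have ET : ep * expR (- lam * T) * step be <= ep * expR (- lam * t) * step be.
  rewrite ler_pM2r// ler_pM2l// ler_expR !mulNr lerN2; exact: ler_wpM2l (ltW tT).
rewrite step0 subr0 in H; apply: le_trans ET _; apply: le_trans H _.
by apply: le_trans ux; rewrite gerBl ltW.
Qed.

(** * Upper limits at the horizon *)

Definition eventual_bounds x : set R :=
  [set B | exists2 s, 0 <= s < T & forall t, s <= t -> t < T -> u x t <= B].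

(** The limsup of [u x t] as t tends to [T] from the left. The set is nonempty and bounded below by
    [eventual_bounds_has_inf], so this is a genuine infimum. *)
Definition left_limsup x : R := inf (eventual_bounds x).

Lemma eventual_bounds_ge0 x : lbound (eventual_bounds x) 0.
Proof.
move=> B [s /andP[s0 sT] H].
exact: le_trans (ltW (sol_gt0 sol x s0 (ltS sT))) (H s (lexx s) sT).
Qed.

Lemma eventual_bounds_has_inf x : has_inf (eventual_bounds x).
Proof.
split; last by exists 0; exact: eventual_bounds_ge0.
have [B B0 uB] := u_bounded; exists B, 0; first by rewrite lexx T0.
by move=> t t0 tT; exact/ltW/uB.
Qed.

Lemma left_limsup_ge0 x : 0 <= left_limsup x.
Proof.
by apply: lb_le_inf (@eventual_bounds_ge0 x); case: (eventual_bounds_has_inf x).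
Qed.

Lemma left_limsup_le x B s : 0 <= s < T ->
  (forall t, s <= t -> t < T -> u x t <= B) -> left_limsup x <= B.
Proof.
move=> sT H; apply: ge_inf; last by exists s.
by case: (eventual_bounds_has_inf x).
Qed.

Lemma left_limsup_eventually x e : 0 < e -> exists2 s, 0 <= s < T &
  forall t, s <= t -> t < T -> u x t <= left_limsup x + e.
Proof.
move=> e0; have [B [s sT H] Be] := inf_adherent e0 (eventual_bounds_has_inf x).
by exists s => // t st tT; apply: le_trans (H t st tT) (ltW Be).
Qed.

(** Letting t tend to [T] shows that the limsup at [x] is at most the liminf at [x + r]. *)
Lemma left_limsup_barrier r : 0 < r -> exists2 C, 0 <= C & forall x t,
  0 <= x -> x + r <= 2^-1 -> 0 <= t -> t < T ->
  left_limsup x <= u (x + r) t + C * (T - t).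
Proof.
move=> r0; have [C C0 H] := upper_barrier r0; exists C => // x t x0 xr t0 tT.
apply: (@left_limsup_le _ _ t); first by rewrite t0.
move=> q tq qT; apply: le_trans (H x t q x0 xr t0 tq qT) _.
by rewrite lerD2l ler_wpM2l// lerD2r ltW.
Qed.

(** Pigeonhole: if the upper limit grew by more than [e] on each of sufficiently many equal pieces
    of [[a, b]], it would exceed its value at [b]. *)
Lemma left_limsup_flat a b e : 0 <= a -> a < b -> b <= 2^-1 -> 0 < e ->
  exists x w, [/\ a <= x, 0 < w, x + w <= b & left_limsup (x + w) - left_limsup x <= e].
Proof.
move=> a0 ab bh e0; apply: contrapT => H.
pose m := Num.bound (left_limsup b / e).
have m0 : 0 < m.+1%:R :> R by rewrite ltr0n.
pose w := (b - a) / m.+1%:R; have w0 : 0 < w by rewrite divr_gt0// subr_gt0.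
have mw : w * m.+1%:R = b - a by rewrite /w divfK// gt_eqF.
have step (k : nat) : (k <= m.+1)%N -> k%:R * e <= left_limsup (a + w * k%:R).
  elim: k => [_|k IH km]; first by rewrite mul0r left_limsup_ge0.
  have IHk := IH (ltnW km).
  have wS : a + w * k%:R + w = a + w * k.+1%:R by rewrite -natr1; ring.
  rewrite leNgt; apply/negP => Hk.
  apply: H; exists (a + w * k%:R), w; split => //.
  - by rewrite lerDl mulr_ge0// ltW.
  - by rewrite wS addrC -lerBrDr -mw ler_pM2l// ler_nat.
  - rewrite wS; move: IHk Hk; rewrite -natr1 mulrDl mul1r.
    by move: (left_limsup _) (left_limsup _) (_ * e) => p q r'; lra.
have := step m.+1 (leqnn _); rewrite mw addrC subrK -ler_pdivlMr// leNgt.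
have Lb : 0 <= left_limsup b / e by rewrite divr_ge0 ?left_limsup_ge0// ltW.
move=> /negP; apply; apply: lt_le_trans (archi_boundP Lb) _.
by rewrite ler_nat.
Qed.

(** On a flat interval [[x, x + w]], late values at the midpoint are almost at least [left_limsup x]
    by the barrier, and those at the right end are almost at most [left_limsup (x + w)]. Each of the
    three errors is at most [e / 4]. *)
Lemma flat_point a b e : 0 <= a -> a < b -> b <= 2^-1 -> 0 < e ->
  exists x h s, [/\ a < x, 0 < h, x + h <= b, 0 <= s < T &
    forall t, s <= t -> t < T -> u (x + h) t - u x t < e].
Proof.
move=> a0 ab bh e0.
have e4 : 0 < e / 4 by rewrite divr_gt0.
have [x [w [ax w0 xwb flat]]] := left_limsup_flat a0 ab bh e4.
have w2 : 0 < w / 2 by rewrite divr_gt0.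
have [C C0 HC] := left_limsup_barrier w2.
have [s1 /andP[s10 s1T] H1] := left_limsup_eventually (x + w) e4.
have d0 : 0 < e / (4 * (C + 1)).
  by rewrite divr_gt0// mulr_gt0// ltr_wpDl.
pose s := Num.max s1 (T - e / (4 * (C + 1))).
exists (x + w / 2), (w / 2), s; split => //.
- by apply: le_lt_trans ax _; rewrite ltrDl.
- by rewrite -addrA -splitr.
- by rewrite le_max s10 gt_max s1T ltrBlDr ltrDl.
move=> t; rewrite ge_max => /andP[s1t st] tT.
have x0 : 0 <= x by exact: le_trans ax.
have t0 : 0 <= t by exact: le_trans s1t.
have := H1 t s1t tT; rewrite -addrA -splitr.
have := HC x t x0 _ t0 tT.
have -> : x + w / 2 <= 2^-1.
  by apply: le_trans bh; apply: le_trans xwb; rewrite lerD2l ler_pdivrMr// ler_peMr ?ler1n// ltW.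
move=> /(_ isT).
have : C * (T - t) <= e / 4.
  apply: (@le_trans _ _ ((C + 1) * (e / (4 * (C + 1))))).
    apply: ler_pM => //; first by rewrite subr_ge0 ltW.
      by rewrite lerDl.
    by rewrite lerBlDr -lerBlDl.
  rewrite le_eqVlt; apply/orP; left; apply/eqP.
  by field; rewrite gt_eqF// ltr_wpDl.
move: flat e0; move: (left_limsup _) (left_limsup _) (u _ _) (u _ _) (C * _) => p q r z c; lra.
Qed.

(** * Convergence at each point *)

Lemma max_nonincreasing s t : 0 < s -> s <= t -> t < T -> u 2^-1 t <= u 2^-1 s.
Proof.
move=> s0 + tT; rewrite le_eqVlt => /orP[/eqP->//|st].
have [B [c [B0 c0 FB uB]]] := max_decay.
have [|z /andP[sz zt] E] := @mvt _ (u 2^-1) (dt u 2^-1) s t st.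
  move=> q /andP[sq qt]; apply: (sol_dt sol); first exact: lt_le_trans sq.
  exact/ltS/(le_lt_trans qt).
have z0 : 0 < z by exact: lt_trans sz.
have zT : z < T by exact: lt_trans tT.
rewrite -subr_le0 E mulr_le0_ge0 ?subr_ge0 ?(ltW st)//.
have uz0 := sol_gt0 sol 2^-1 (ltW z0) (ltS zT).
have uzB : u 2^-1 z <= B.
  apply: le_trans (ltW (uB z (ltW z0) (ltS zT))) _.
  by rewrite gerBl mulr_ge0// ltW.
have : N / B <= N / u 2^-1 z.
  apply: ler_wpM2l; first exact: reaction_ge0.
  by rewrite lef_pV2 ?posrE.
have := dt_half_le z0 (ltS zT).
by move: FB c0; move: (N / B) (N / _) (f _) (dt _ _ _) => p q r w; lra.
Qed.

Lemma left_limsup_half_le t : 0 < t -> t < T -> left_limsup 2^-1 <= u 2^-1 t.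
Proof.
move=> t0 tT; apply: (@left_limsup_le _ _ t); first by rewrite (ltW t0).
by move=> q tq qT; exact: max_nonincreasing.
Qed.

(** Flat points [al < x < be] control the lateral boundary of the comparison of [u (x + H t) t] with
    [u x t], which then differ by less than [e / 2]. The barrier bounds [left_limsup x] by the
    former up to another [e / 2]. *)
Lemma liminf_ge x e : 0 < x -> x < 2^-1 -> 0 < e -> exists2 s, 0 <= s < T &
  forall t, s <= t -> t < T -> left_limsup x - e <= u x t.
Proof.
move=> x0 xh e0.
have x2 : 0 < x / 2 by rewrite divr_gt0.
have x2x : x / 2 < x by rewrite ltr_pdivrMr// ltr_pMr// ltr1n.
have [kap kap0 [s0 /andP[s00 s0T] ukap]] := interior_positive x2 (ltW (lt_trans x2x xh)).
have [F1 F10 fL] := f_lipschitz.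
pose K := N / kap ^+ 2 + 1.
have K0 : 0 <= K by rewrite addr_ge0// divr_ge0 ?reaction_ge0// exprn_ge0// ltW.
(* The margin is normalised to grow from [e1] at time 0 to [e / 2] at time [T]. *)
pose P t := e / 2 * expR (- (K * T)) * expR (K * t).
pose e1 := e / 2 * expR (- (K * T)).
have e10 : 0 < e1 by rewrite mulr_gt0 ?expR_gt0// divr_gt0.
have P0 t : 0 < P t by rewrite mulr_gt0 ?expR_gt0.
have Pge t : 0 <= t -> e1 <= P t.
  by move=> t0; rewrite ler_peMr ?(ltW e10)// -expR0 ler_expR mulr_ge0.
have Ple t : t <= T -> P t <= e / 2.
  move=> tT; rewrite /P -mulrA -expRD ler_piMr ?divr_ge0 ?(ltW e0)//.
  by rewrite -expR0 ler_expR addrC subr_le0 ler_wpM2l.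
have [al [ha [sa [xal ha0 alx /andP[sa0 saT] Ha]]]] :=
  flat_point (ltW x2) x2x (ltW xh) e10.
have [be [hb [sb [xbe hb0 beh /andP[sb0 sbT] Hb]]]] :=
  flat_point (ltW x0) xh (lexx _) e10.
pose s := Num.max s0 (Num.max sa sb).
have ss0 : s0 <= s by rewrite le_max lexx.
have ssa : sa <= s by rewrite !le_max lexx orbT.
have ssb : sb <= s by rewrite !le_max lexx !orbT.
have sT : s < T by rewrite !gt_max s0T saT.
have spos : 0 < s by exact: lt_le_trans ss0.
have [M M0 uL] := u_lipschitz spos sT.
pose D := M + F1 + 1.
have D0 : 0 < D by rewrite ltr_wpDl// addr_ge0.
(* The bounds [ha] and [hb] serve the two lateral conditions; the third makes both [M * H t] and
   [F1 * H t] smaller than [e1], for the initial condition and for the forcing term. *)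
pose h1 := Num.min ha (Num.min hb (e1 / (2 * D))).
have h10 : 0 < h1 by rewrite !lt_min ha0 hb0 divr_gt0// mulr_gt0.
have h1a : h1 <= ha by rewrite ge_min lexx.
have h1b : h1 <= hb by rewrite !ge_min lexx orbT.
have h1D : D * h1 < e1.
  apply: (@le_lt_trans _ _ (D * (e1 / (2 * D)))).
    by rewrite ler_pM2l// !ge_min lexx !orbT.
  rewrite (_ : D * _ = e1 / 2); last by field; rewrite gt_eqF.
  by rewrite ltr_pdivrMr// ltr_pMr// ltr1n.
pose H t := h1 * expR (- F1 * t).
have Hle t : 0 <= t -> H t <= h1.
  move=> t0; rewrite ler_piMr ?(ltW h10)// -expR0 ler_expR mulNr oppr_le0.
  exact: mulr_ge0.
have H0 t : 0 <= H t by rewrite mulr_ge0 ?expR_ge0// ltW.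
have MH t : 0 <= t -> M * H t < e1.
  move=> t0; apply: le_lt_trans h1D; apply: ler_pM => //; last exact: Hle.
  by rewrite /D -addrA lerDl addr_ge0.
have FH t : 0 <= t -> F1 * H t < e1.
  move=> t0; apply: le_lt_trans h1D; apply: ler_pM => //; last exact: Hle.
  by rewrite /D addrAC lerDr addr_ge0.
(* The shift never falls below [hm > 0], so one barrier constant serves all times. *)
pose hm := H T.
have hm0 : 0 < hm by rewrite mulr_gt0// expR_gt0.
have Hhm t : t <= T -> hm <= H t.
  by move=> tT; rewrite ler_pM2l// ler_expR !mulNr lerN2 ler_wpM2l.
have alx' : al < x by apply: lt_le_trans alx; rewrite ltrDl.
have al0 : 0 < al by exact: lt_trans xal.
have key t : s <= t -> t < T -> u (x + H t) t - u x t < P t.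
  move=> st tT.
  have tt : s <= t <= t by rewrite st lexx.
  apply: (@shift_bound al be s t F1 kap H P al0 (ltW spos) tT kap0 F10 fL) => //.
  - move=> y q yal yh /andP[sq qt]; apply: ukap => //.
    + exact: le_trans (ltW xal) yal.
    + exact: le_trans sq.
    + exact: le_lt_trans tT.
  - move=> q; rewrite /H; apply: has_deriv_eqr; first by derive_rules.
    by rewrite /=; ring.
  - move=> q; rewrite /P; apply: has_deriv_eqr; first by derive_rules.
    by rewrite /= -/K; ring.
  - move=> q /andP[sq qt]; split => //; apply: le_trans beh; rewrite lerD2l.
    by apply: le_trans h1b; apply: Hle; apply: le_trans sq; exact: ltW.
  - move=> q /andP[sq qt]; have q0 : 0 <= q by apply: le_trans sq; exact: ltW.
    exact: lt_le_trans (FH q q0) (Pge q q0).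
  - move=> q /andP[sq qt]; have q0 : 0 <= q by apply: le_trans sq; exact: ltW.
    have qT : q < T by exact: le_lt_trans tT.
    apply: lt_le_trans (Pge q q0).
    apply: le_lt_trans (Ha q (le_trans ssa sq) qT); rewrite lerD2r.
    apply: u_le => //; first exact: ltS.
    + by apply: addr_ge0 => //; exact: ltW.
    + by rewrite lerD2l; apply: le_trans h1a; exact: Hle.
    + exact: le_trans alx (ltW xh).
  - move=> q /andP[sq qt]; have q0 : 0 <= q by apply: le_trans sq; exact: ltW.
    have qT : q < T by exact: le_lt_trans tT.
    apply: lt_le_trans (Pge q q0).
    apply: le_lt_trans (Hb q (le_trans ssb sq) qT); rewrite lerD2r.
    apply: u_le => //; first exact: ltS.
    + by apply: addr_ge0 => //; apply: le_trans (ltW x0) (ltW xbe).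
    + by rewrite lerD2l; apply: le_trans h1b; exact: Hle.
  - move=> y /andP[aly ybe].
    apply: lt_le_trans (Pge s (ltW spos)).
    apply: le_lt_trans (MH s (ltW spos)); apply: uL => //.
    + exact: le_trans (ltW al0) aly.
    + apply: le_trans beh; apply: lerD => //.
      by apply: le_trans h1b; apply: Hle; exact: ltW.
  - by rewrite (ltW alx') ltW.
have [C C0 HC] := left_limsup_barrier hm0.
have xhm t : s <= t -> t < T -> x + hm <= x + H t /\ x + H t <= 2^-1.
  move=> st tT; split; first by rewrite lerD2l; apply: Hhm; exact: ltW.
  apply: le_trans beh; apply: lerD; first exact: ltW.
  by apply: le_trans h1b; apply: Hle; apply: le_trans st; exact: ltW.
have d0 : 0 < e / (2 * (C + 1)) by rewrite divr_gt0// mulr_gt0// ltr_wpDl.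
exists (Num.max s (T - e / (2 * (C + 1)))).
  by rewrite le_max (ltW spos) gt_max sT ltrBlDr ltrDl.
move=> t; rewrite ge_max => /andP[st st'] tT.
have t0 : 0 <= t by apply: le_trans st; exact: ltW.
have [xh1 xh2] := xhm t st tT.
have h1' := HC x t (ltW x0) (le_trans xh1 xh2) t0 tT.
have h2 : u (x + hm) t <= u (x + H t) t.
  apply: u_le => //; first exact: ltS.
  by apply: addr_ge0; exact: ltW.
have h3 := key t st tT.
have h4 := Ple t (ltW tT).
have h5 : C * (T - t) <= e / 2.
  apply: (@le_trans _ _ ((C + 1) * (e / (2 * (C + 1))))).
    apply: ler_pM => //; first by rewrite subr_ge0 ltW.
      by rewrite lerDl.
    by rewrite lerBlDr -lerBlDl.
  rewrite le_eqVlt; apply/orP; left; apply/eqP.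
  by field; rewrite gt_eqF// ltr_wpDl.
move: h1' h2 h3 h4 h5.
move: (left_limsup _) (u _ _) (u _ _) (u _ _) (C * _) (P t) => p q r z c w; lra.
Qed.

Lemma cvg_left_limsup x : 0 < x -> x <= 2^-1 -> u x t @[t --> T^'-] --> left_limsup x.
Proof.
move=> x0 xh; apply/cvgrPdist_le => e e0.
have [s1 /andP[s10 s1T] H1] := left_limsup_eventually x e0.
have [s2 /andP[s20 s2T] H2] : exists2 s, 0 <= s < T &
    forall t, s <= t -> t < T -> left_limsup x - e <= u x t.
  (* At [1/2] no flat point is available on the right within [[0, 1/2]]; monotonicity in time gives
     the lower bound instead. *)
  move: xh; rewrite le_eqVlt => /orP[/eqP xE|xh]; last exact: liminf_ge.
  exists (T / 2) => [|t t2 tT].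
    by rewrite divr_ge0 ?(ltW T0)//= ltr_pdivrMr// ltr_pMr// ltr1n.
  rewrite xE; apply: (@le_trans _ _ (left_limsup 2^-1)); first by rewrite gerBl ltW.
  by apply: left_limsup_half_le => //; apply: lt_le_trans t2; rewrite divr_gt0.
near=> t.
have tT : t < T by near: t; exact: nbhs_left_lt.
have t1 : s1 <= t by near: t; exact: nbhs_left_ge.
have t2 : s2 <= t by near: t; exact: nbhs_left_ge.
by rewrite ler_distl lerBlDr H1//= -lerBlDr H2.
Unshelve. all: by end_near. Qed.

Lemma left_limsup_gt0 x : 0 < x -> x <= 2^-1 -> 0 < left_limsup x.
Proof.
move=> x0 xh; have [kap kap0 [s0 /andP[s00 s0T] ukap]] := interior_positive x0 xh.
apply: (lt_le_trans kap0); apply: lb_le_inf.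
  by case: (eventual_bounds_has_inf x).
move=> B [s /andP[s_ge0 sT] H].
have mT : Num.max s s0 < T by rewrite gt_max sT.
apply: le_trans (H (Num.max s s0) _ mT); last by rewrite le_max lexx.
by apply: ukap => //; rewrite le_max lexx orbT.
Qed.

Lemma cvg_0 : u 0 t @[t --> T^'-] --> (0 : R).
Proof.
apply/cvgrPdist_le => e e0; have [s /andP[s0 sT] H] := min_quenches e0.
near=> t.
have tT : t < T by near: t; exact: nbhs_left_lt.
have st : s <= t by near: t; exact: nbhs_left_ge.
have t0 : 0 <= t by apply: le_trans st; exact: ltW.
rewrite sub0r normrN gtr0_norm; first exact/ltW/H.
exact: (sol_gt0 sol) (ltS tT).
Unshelve. all: by end_near. Qed.

End Flow.

(** * Identification of the quenching time and passage to the whole line *)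

Unset Implicit Arguments.

Theorem theorem1p3 (R : realType) (n : nat) (f g : R -> R)
    (S : \bar R) (u : R -> R -> R)
    (hn : (1 <= n)%N)
    (hf : torus_pos_Ck 1 f)
    (hg : torus_pos_Ck 2 g)
    (f_sym : forall x : R, 0 <= x <= 1 -> f x = f (1 - x))
    (g_sym : forall x : R, 0 <= x <= 1 -> g x = g (1 - x))
    (f_mono : forall x : R, 0 <= x <= 2^-1 -> 0 <= derive1 f x)
    (g_mono : forall x : R, 0 <= x <= 2^-1 -> 0 <= derive1 g x)
    (g_lt : g 0 < g 2^-1)
    (hmax : sup (range f) * sup (range g) < n%:R - 1)
    (hu : maximal_solution n f g S u) :
  exists T : R,
    [/\ quenching_time S u = T%:E,
        forall k : int, u k%:~R t @[t --> T^'-] --> (0 : R) &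
        forall x : R, x \isn't a Num.int ->
          exists l : R, 0 < l /\ (u x t @[t --> T^'-] --> l)].
Proof.
have [S0 sol hinf] := hu.
(* Both functions are bounded by their values at [1/2], so the suprema are over bounded sets and
   dominate these values. *)
have hm : f 2^-1 * g 2^-1 < n%:R - 1.
  apply: le_lt_trans hmax; apply: ler_pM.
  - by apply/ltW/(f_gt0 hf).
  - by apply/ltW/(g_gt0 hg).
  - apply: ub_le_sup; last by exists 2^-1.
    by exists (f 2^-1) => _ [x _ <-]; exact: (f_le_half hf f_sym f_mono).
  - apply: ub_le_sup; last by exists 2^-1.
    by exists (g 2^-1) => _ [x _ <-]; exact: (g_le_half hg g_sym g_mono).
have [T T0 ST] := horizon_finite sol hn hf hg f_sym g_sym f_mono g_mono hm S0.
have {}hinf : inf [set u p.1 p.2 | p in slab S] = 0 by apply: hinf; rewrite ST ltry.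
have TS t : t < T -> (t%:E < S)%E by rewrite ST lte_fin.
have ubnd x t : 0 <= t -> (t%:E < S)%E -> u 0 t <= u x t.
  move=> t0 tS.
  by have /andP[] := u_bounds sol hn hf hg f_sym g_sym f_mono g_mono x t0 tS.
exists T; split.
- rewrite /quenching_time; apply/eqP; rewrite eq_le; apply/andP; split.
    by apply: ge_ereal_sup => _ [t [_ + _] <-]; rewrite ST => /ltW.
  (* Every time in [(0, T)] belongs to the set defining the quenching time, because [u 0 t > 0] is a
     lower bound in space. *)
  apply/lee_subgt0Pr => e e0.
  pose t := Num.max (T / 2) (T - e).
  have t0 : 0 < t by rewrite lt_max divr_gt0.
  have tT : t < T.
    by rewrite gt_max ltr_pdivrMr// ltr_pMr// ltr1n/= gtrBl.
  apply: (@le_trans _ _ t%:E); first by rewrite lee_fin le_max lexx orbT.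
  apply: ereal_sup_ubound; exists t => //; split => //; first exact: TS.
  apply: (@lt_le_trans _ _ (u 0 t)); first exact: (sol_gt0 sol 0 (ltW t0) (TS _ tT)).
  apply: lb_le_inf; first by exists (u 0 t), 0.
  by move=> _ [x _ <-]; apply: ubnd; [exact: ltW|exact: TS].
- move=> k.
  apply: cvg_trans (cvg_0 sol hn hf hg f_sym g_sym f_mono g_mono T0 ST hinf).
  apply: near_eq_cvg; near=> t.
  have tT : t < T by near: t; exact: nbhs_left_lt.
  have t0 : 0 <= t by near: t; exact: nbhs_left_ge.
  by rewrite -(periodic_int (sol_periodic sol t0 (TS _ tT)) k 0) add0r.
move=> x xN.
have [y [k [/andP[y0 yh] xE]]] := fold_half x.
(* The representative 0 would make [x] an integer. *)
have {}y0 : 0 < y.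
  rewrite lt_neqAle y0 andbT; apply/eqP => yE; move: xN.
  by case: xE => ->; rewrite -yE ?oppr0 add0r intr_int.
exists (left_limsup u T y); split.
  exact: (left_limsup_gt0 sol hn hf hg f_sym g_sym f_mono g_mono g_lt hm T0 ST y0 yh).
apply: cvg_trans (cvg_left_limsup sol hn hf hg f_sym g_sym f_mono g_mono g_lt hm T0 ST y0 yh).
apply: near_eq_cvg; near=> t.
have tT : t < T by near: t; exact: nbhs_left_lt.
have t0 : 0 <= t by near: t; exact: nbhs_left_ge.
have up := sol_periodic sol t0 (TS _ tT).
case: xE => ->; rewrite (periodic_int up) //.
by rewrite (u_even sol hn hf hg f_sym g_sym y t0 (TS _ tT)).
Unshelve. all: by end_near. Qed.
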